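(* The Dota Underlords problem in which all alliances have size 2 reduces to the maximum edge-weighted clique problem: there is an edge-weighted graph, of size bounded by a polynomial in the size of the Dota Underlords instance, such that an optimal solution of the Dota Underlords instance is obtained from a maximum edge-weighted clique of that graph.
   Context: The Dota Underlords (DU) problem. An instance consists of: $n\in\mathbb{N}$ heroes; a maximum team size $m\in\mathbb{N}$; $t\in\mathbb{N}$ alliances; a maximum alliance size $q\in\mathbb{N}$; hero strengths $s_i\in\mathbb{R}$; an incidence matrix $a_{ij}\in\{0,1\}$ with $a_{ij}=1$ iff hero $i$ belongs to alliance $j$, satisfying $\sum_{i=1}^n a_{ij}\le q$ for every $j$; and bonuses $e_{ijk}\in\mathbb{R}$ ($1\le i\le n$, $1\le j\le t$, $1\le k\le q$), where $e_{ijk}$ is the bonus to hero $i$ when at least $k$ heroes of alliance $j$ are in the team. The problem is the integer program: maximize $\sum_{i=1}^n x_i s_i+\sum_{i,j,k} e_{ijk}I_{ijk}$ over $x_i\in\{0,1\}$ ($x_i=1$ iff hero $i$ is in the team) and $I_{ijk}\in\{0,1\}$, subject to $\sum_{i=1}^n x_i\le m$; $I_{ijk}\le x_i$ for all $i,j,k$; and $\sum_{i'=1}^n a_{i'j}x_{i'}-k\ge M(I_{ijk}-1)$ for all $i,j,k$, where $M$ is a constant larger than $q$ (so $I_{ijk}=1$ is possible only if the team contains at least $k$ heroes of alliance $j$). ''Alliances of size 2'' means every alliance $j$ satisfies $\sum_i a_{ij}=2$. The maximum edge-weighted clique (MEWC) problem: given an undirected graph with real edge weights, find a clique maximizing the total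 weight of its edges. *)

(* Defs.v *)
From mathcomp Require Import all_boot all_order all_algebra.
From mathcomp Require Import reals.

Set Implicit Arguments.
Unset Strict Implicit.
Unset Printing Implicit Defensive.

Import Order.TTheory GRing.Theory Num.Theory.
Local Open Scope ring_scope.

(** * The Dota Underlords problem *)

(* Heroes, alliances and thresholds are 0-based: the index [k : 'I_q] stands
   for the threshold [k.+1]. *)
Record du_instance (R : realType) := DUInstance {
  heroes : nat;
  team_size : nat;
  alliances : nat;
  max_alliance : nat;
  strength : 'I_heroes -> R;
  member : 'I_heroes -> 'I_alliances -> bool;
  bonus : 'I_heroes -> 'I_alliances -> 'I_max_alliance -> R;
  bigM : R;
  _ : forall j, (\sum_i member i j <= max_alliance)%N;
  _ : max_alliance%:R < bigM
}.

Record du_solution (R : realType) (D : du_instance R) := DUSolution {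
  in_team : 'I_(heroes D) -> bool;
  active : 'I_(heroes D) -> 'I_(alliances D) -> 'I_(max_alliance D) -> bool
}.

Section DU.
Context {R : realType} (D : du_instance R).

Definition du_feasible (S : du_solution D) : Prop :=
  [/\ (\sum_i in_team S i <= team_size D)%N,
      forall i j k, (active S i j k <= in_team S i)%N
    & forall i j k,
        bigM D * ((active S i j k)%:R - 1) <=
        (\sum_i' member i' j * in_team S i')%N%:R - k.+1%:R].

Definition du_value (S : du_solution D) : R :=
  \sum_i (in_team S i)%:R * strength i +
  \sum_i \sum_j \sum_k bonus i j k * (active S i j k)%:R.

Definition du_optimal (S : du_solution D) : Prop :=
  du_feasible S /\ forall S', du_feasible S' -> du_value S' <= du_value S.

Definition alliances_of_size2 : Prop :=
  forall j : 'I_(alliances D), (\sum_i member i j = 2)%N.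

End DU.

(** * The maximum edge-weighted clique problem *)

(* Only the values of [weight] on adjacent pairs are meaningful. *)
Record wgraph (R : realType) := WGraph {
  nverts : nat;
  adj : rel 'I_nverts;
  weight : 'I_nverts -> 'I_nverts -> R;
  _ : symmetric adj;
  _ : irreflexive adj;
  _ : forall u v, weight u v = weight v u
}.

Section MEWC.
Context {R : realType} (G : wgraph R).

Definition edges : {set 'I_(nverts G) * 'I_(nverts G)} :=
  [set p : 'I_(nverts G) * 'I_(nverts G) | (p.1 < p.2)%N && adj p.1 p.2].

Definition graph_size : nat := nverts G + #|edges|.

Definition clique (K : {set 'I_(nverts G)}) : Prop :=
  {in K &, forall u v, u != v -> adj u v}.

Definition clique_weight (K : {set 'I_(nverts G)}) : R :=
  \sum_(u in K) \sum_(v in K | (u < v)%N) weight u v.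

Definition max_clique (K : {set 'I_(nverts G)}) : Prop :=
  clique K /\ forall K', clique K' -> clique_weight K' <= clique_weight K.

End MEWC.

(** * Polynomial-time computation with real data *)

(* Reductions are computed by programs of a real random-access machine.  A
   state holds two families of arrays with three indices, one of naturals and
   one of reals; the array [a] serves as a scalar through its cell (0,0,0).
   - Operations on reals are additions, subtractions and comparisons, at unit
     cost: without multiplication the bit-length of rational data stays
     polynomial.
   - Operations on naturals (including array accesses) are charged the
     bit-length of their result, so that products cannot be exploited to
     compute with numbers of super-polynomial length.
   - The only loops are [For] loops whose bound is evaluated on entry, which
     makes the semantics total; a polynomial-time computation can always be
     written this way, by using its time bound as the bound of a loop. *)

Definition bitlen (n : nat) : nat := (trunc_log 2 n).+1.

Inductive nexp :=
| NConst of nat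
| NGet (a : nat) (i j k : nexp)
| NAdd of nexp & nexp
| NSub of nexp & nexp
| NMul of nexp & nexp
| NDiv of nexp & nexp
| NMod of nexp & nexp.

Inductive rexp :=
| RNat of nexp
| RGet (a : nat) (i j k : nexp)
| RAdd of rexp & rexp
| RSub of rexp & rexp.

(* [IfN e1 e2 c1 c2] and [IfR r1 r2 c1 c2] test [e1 <= e2] and [r1 <= r2];
   [For x e c] runs [c] with the scalar [x] set to 0, ..., e - 1. *)
Inductive cmd :=
| Skip
| NSet (a : nat) (i j k : nexp) (e : nexp)
| RSet (a : nat) (i j k : nexp) (r : rexp)
| Seq of cmd & cmd
| IfN (e1 e2 : nexp) (c1 c2 : cmd)
| IfR (r1 r2 : rexp) (c1 c2 : cmd)
| For (x : nat) (e : nexp) (c : cmd).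

Definition upd (T : Type) (f : nat -> nat -> nat -> nat -> T)
    (a i j k : nat) (v : T) : nat -> nat -> nat -> nat -> T :=
  fun a' i' j' k' =>
    if [&& a' == a, i' == i, j' == j & k' == k] then v else f a' i' j' k'.

(* [nmem s a i j k] is the cell [(i, j, k)] of the array [a]. *)
Record state (R : Type) := State {
  nmem : nat -> nat -> nat -> nat -> nat;
  rmem : nat -> nat -> nat -> nat -> R
}.

Section Semantics.
Context {R : realType}.
Implicit Types s : state R.

Definition nset s a i j k v : state R :=
  State (upd (nmem s) a i j k v) (rmem s).
Definition rset s a i j k v : state R :=
  State (nmem s) (upd (rmem s) a i j k v).

Fixpoint neval s (e : nexp) : nat :=
  match e with
  | NConst n => n
  | NGet a i j k => nmem s a (neval s i) (neval s j) (neval s k)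
  | NAdd e1 e2 => neval s e1 + neval s e2
  | NSub e1 e2 => neval s e1 - neval s e2
  | NMul e1 e2 => neval s e1 * neval s e2
  | NDiv e1 e2 => neval s e1 %/ neval s e2
  | NMod e1 e2 => neval s e1 %% neval s e2
  end%N.

Fixpoint reval s (r : rexp) : R :=
  match r with
  | RNat e => (neval s e)%:R
  | RGet a i j k => rmem s a (neval s i) (neval s j) (neval s k)
  | RAdd r1 r2 => reval s r1 + reval s r2
  | RSub r1 r2 => reval s r1 - reval s r2
  end.

Fixpoint ncost s (e : nexp) : nat :=
  (bitlen (neval s e) +
   match e with
   | NConst _ => 0
   | NGet _ i j k => ncost s i + ncost s j + ncost s k
   | NAdd e1 e2 | NSub e1 e2 | NMul e1 e2 | NDiv e1 e2 | NMod e1 e2 =>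
       ncost s e1 + ncost s e2
   end)%N.

Fixpoint rcost s (r : rexp) : nat :=
  match r with
  | RNat e => (ncost s e).+1
  | RGet _ i j k => (ncost s i + ncost s j + ncost s k).+1
  | RAdd r1 r2 | RSub r1 r2 => (rcost s r1 + rcost s r2).+1
  end%N.

Fixpoint exec (c : cmd) s : state R :=
  match c with
  | Skip => s
  | NSet a i j k e =>
      nset s a (neval s i) (neval s j) (neval s k) (neval s e)
  | RSet a i j k r =>
      rset s a (neval s i) (neval s j) (neval s k) (reval s r)
  | Seq c1 c2 => exec c2 (exec c1 s)
  | IfN e1 e2 c1 c2 =>
      if (neval s e1 <= neval s e2)%N then exec c1 s else exec c2 s
  | IfR r1 r2 c1 c2 =>
      if reval s r1 <= reval s r2 then exec c1 s else exec c2 s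
  | For x e c1 =>
      iteri (neval s e) (fun i s' => exec c1 (nset s' x 0 0 0 i)) s
  end.

Fixpoint cost (c : cmd) s : nat :=
  match c with
  | Skip => 1
  | NSet _ i j k e => (ncost s i + ncost s j + ncost s k + ncost s e).+1
  | RSet _ i j k r => (ncost s i + ncost s j + ncost s k + rcost s r).+1
  | Seq c1 c2 => (cost c1 s + cost c2 (exec c1 s)).+1
  | IfN e1 e2 c1 c2 =>
      (ncost s e1 + ncost s e2 +
       if neval s e1 <= neval s e2 then cost c1 s else cost c2 s).+1
  | IfR r1 r2 c1 c2 =>
      (rcost s r1 + rcost s r2 +
       if (reval s r1 <= reval s r2)%R then cost c1 s else cost c2 s).+1
  | For x e c1 =>
      let before i :=
        nset (iteri i (fun i' s' => exec c1 (nset s' x 0 0 0 i')) s)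
             x 0 0 0 i in
      (ncost s e + \sum_(i < neval s e) (bitlen i + cost c1 (before i))).+1
  end%N.

End Semantics.

(** * Input and output conventions *)

(* Arrays of naturals:  0 number of heroes, 1 team size, 2 number of alliances,
     3 maximum alliance size, 4 incidence matrix, 5 order of the graph,
     6 adjacency matrix, 7 clique, 8 team, 9 active bonuses.
   Arrays of reals:  0 strengths, 1 bonuses, 2 the constant M, 3 edge weights.
   All other cells are initially 0. *)

Section Encoding.
Context {R : realType} (D : du_instance R).

(* The length of the input, a real number having length 1 and a natural number
   its bit-length. *)
Definition du_size : nat :=
  bitlen (heroes D) + bitlen (team_size D) + bitlen (alliances D)
  + bitlen (max_alliance D)
  + heroes D + heroes D * alliances D
  + heroes D * alliances D * max_alliance D + 1.

(* A partial function on ordinals, extended to all naturals by [x0]. *)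
Definition ext (T : Type) (x0 : T) (n : nat) (f : 'I_n -> T) (i : nat) : T :=
  if insub i is Some i' then f i' else x0.

Definition du_input : state R :=
  State
    (fun a i j k =>
       match a, i, j, k with
       | 0, 0, 0, 0 => heroes D
       | 1, 0, 0, 0 => team_size D
       | 2, 0, 0, 0 => alliances D
       | 3, 0, 0, 0 => max_alliance D
       | 4, i, j, 0 =>
           ext 0 (fun i' => ext 0 (fun j' => @member R D i' j' : nat) j) i
       | _, _, _, _ => 0
       end%N)
    (fun a i j k =>
       match a, i, j, k with
       | 0%N, i, 0%N, 0%N => ext 0 (@strength R D) i
       | 1%N, i, j, k =>
           ext 0 (fun i' => ext 0 (fun j' => ext 0 (@bonus R D i' j') k) j) i
       | 2%N, 0%N, 0%N, 0%N => bigM D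
       | _, _, _, _ => 0
       end).

Definition du_clique_input (n : nat) (K : {set 'I_n}) : state R :=
  State
    (fun a i j k =>
       match a, j, k with
       | 7, 0, 0 => ext 0 (fun v => (v \in K) : nat) i
       | _, _, _ => nmem du_input a i j k
       end%N)
    (rmem du_input).

Definition graph_output (s : state R) (G : wgraph R) : Prop :=
  [/\ nmem s 5 0 0 0 = nverts G,
      forall u v : 'I_(nverts G), adj u v = (nmem s 6 u v 0 != 0%N)
    & forall u v : 'I_(nverts G), adj u v -> weight u v = rmem s 3 u v 0].

Definition du_output (s : state R) : du_solution D :=
  DUSolution (fun i => nmem s 8 i 0 0 != 0%N)
             (fun i j k => nmem s 9 i j k != 0%N).

End Encoding.

(* Main.v *)
Require Import Defs.
From mathcomp Require Import all_boot all_order all_algebra.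
From mathcomp Require Import reals zify lra.

(* With n heroes and t alliances of size 2, the graph consists of n + 2t + 1
   groups of n + 1 vertices, its "states"; vertices of the same group are not
   adjacent.
   - Hero i is in state 0 when out of the team and in state p > 0 when it
     occupies slot p of the team.  Only slots up to the team size are legal and
     two heroes cannot share a slot, which encodes the cardinality constraint
     by pairwise conditions.
   - Alliance j has two groups, one for each threshold.  In a nonzero state, the
     first claims that a given member of j is in the team and the second that
     all members are; a claim is adjacent to no hero vertex contradicting it.
   - The last group is always on and carries the strengths.
   The bonus of hero i for threshold k of alliance j depends on up to three
   heroes, but on two groups only: it is put, truncated at 0, on the edges
   between nonzero states of hero i and of the k-th group of j.  Every edge
   between a hero and another kind of group moreover has a weight W larger than
   the sum of all positive bonuses and strengths, so that a maximum clique meets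
   every group.  A group is then in a nonzero state iff its vertex of state 0 is
   not in the clique, which makes decoding immediate. *)

Set Implicit Arguments.
Unset Strict Implicit.
Unset Printing Implicit Defensive.

Import Order.TTheory GRing.Theory Num.Theory.
Local Open Scope ring_scope.

(** * Cost of programs *)

Section Bitlen.
Local Open Scope nat_scope.

Lemma leq_bitlen n k : (bitlen n <= k.+1) = (n < 2 ^ k.+1).
Proof.
rewrite /bitlen ltnS; apply/idP/idP => h.
  by rewrite (leq_trans (trunc_log_ltn n (isT : 1 < 2))) // leq_exp2l.
case: n h => [|n] h; first by rewrite trunc_log0.
rewrite leqNgt; apply/negP => ltk; move: h; rewrite ltnNge => /negP; apply.
by apply: leq_trans (trunc_logP (isT : 1 < 2) (ltn0Sn n)); rewrite leq_exp2l.
Qed.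

Lemma bitlen_ltn n : n < 2 ^ bitlen n.
Proof. by have := leq_bitlen n (trunc_log 2 n); rewrite leqnn => <-. Qed.

Lemma leq_bitlen2 m n : m <= n -> bitlen m <= bitlen n.
Proof. by move=> h; rewrite /bitlen leq_bitlen (leq_ltn_trans h) ?bitlen_ltn. Qed.

Lemma bitlen_leqS n : bitlen n <= n.+1.
Proof. by rewrite leq_bitlen (ltn_trans (ltnSn n)) // ltn_expl. Qed.

Lemma bitlenD m n : bitlen (m + n) <= bitlen m + bitlen n.
Proof.
have [k Ek] : exists k, bitlen m + bitlen n = k.+1 by exists (bitlen m + bitlen n).-1.
rewrite Ek leq_bitlen -Ek expnD.
have := bitlen_ltn m; have := bitlen_ltn n.
have: 2 <= 2 ^ bitlen m by rewrite -{1}(expn1 2) leq_exp2l.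
have: 2 <= 2 ^ bitlen n by rewrite -{1}(expn1 2) leq_exp2l.
nia.
Qed.

Lemma bitlenM m n : bitlen (m * n) <= bitlen m + bitlen n.
Proof.
have [k Ek] : exists k, bitlen m + bitlen n = k.+1 by exists (bitlen m + bitlen n).-1.
rewrite Ek leq_bitlen -Ek expnD.
by have := bitlen_ltn m; have := bitlen_ltn n; nia.
Qed.

End Bitlen.

(** * Static cost bounds for programs *)

Fixpoint nexp_bits (e : nexp) : nat :=
  match e with
  | NConst n => bitlen n
  | NGet _ _ _ _ => 1
  | NAdd e1 e2 | NMul e1 e2 => nexp_bits e1 + nexp_bits e2
  | NSub e1 _ | NDiv e1 _ | NMod e1 _ => nexp_bits e1
  end%N.

Fixpoint nexp_steps (e : nexp) : nat :=
  (nexp_bits e +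
   match e with
   | NConst _ => 0
   | NGet _ i j k => nexp_steps i + nexp_steps j + nexp_steps k
   | NAdd e1 e2 | NSub e1 e2 | NMul e1 e2 | NDiv e1 e2 | NMod e1 e2 =>
       nexp_steps e1 + nexp_steps e2
   end)%N.

Fixpoint rexp_steps (r : rexp) : nat :=
  match r with
  | RNat e => (nexp_steps e).+1
  | RGet _ i j k => (nexp_steps i + nexp_steps j + nexp_steps k).+1
  | RAdd r1 r2 | RSub r1 r2 => (rexp_steps r1 + rexp_steps r2).+1
  end%N.

(* Bounds the cost of [c] when every value stored has at most [l] bits and
   every loop runs at most [l] times. *)
Fixpoint cmd_steps (l : {poly nat}) (c : cmd) : {poly nat} :=
  match c with
  | Skip => 1
  | NSet _ i j k e =>
      (nexp_steps i + nexp_steps j + nexp_steps k + nexp_steps e).+1%:P * l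
  | RSet _ i j k r =>
      (nexp_steps i + nexp_steps j + nexp_steps k + rexp_steps r).+1%:P * l
  | Seq c1 c2 => cmd_steps l c1 + cmd_steps l c2 + 1
  | IfN e1 e2 c1 c2 =>
      (nexp_steps e1 + nexp_steps e2).+1%:P * l + cmd_steps l c1 + cmd_steps l c2
  | IfR r1 r2 c1 c2 =>
      (rexp_steps r1 + rexp_steps r2).+1%:P * l + cmd_steps l c1 + cmd_steps l c2
  | For _ e c1 => (nexp_steps e).+1%:P * l + l * (l + cmd_steps l c1)
  end.

(** A syntactic over-approximation of the arrays that a command may modify, loop counters included;
    it yields the frame properties used in loops. *)
Fixpoint nwrites (a : nat) (c : cmd) : bool :=
  match c with
  | Skip | RSet _ _ _ _ _ => false
  | NSet b _ _ _ _ => a == b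
  | Seq c1 c2 | IfN _ _ c1 c2 | IfR _ _ c1 c2 => nwrites a c1 || nwrites a c2
  | For x _ c1 => (a == x) || nwrites a c1
  end.

Fixpoint rwrites (a : nat) (c : cmd) : bool :=
  match c with
  | Skip | NSet _ _ _ _ _ => false
  | RSet b _ _ _ _ => a == b
  | Seq c1 c2 | IfN _ _ c1 c2 | IfR _ _ c1 c2 => rwrites a c1 || rwrites a c2
  | For _ _ c1 => rwrites a c1
  end.

Section Machine.
Context {R : realType}.
Implicit Types s : state R.

Lemma nmem_nset s a i j k v a' i' j' k' :
  nmem (nset s a i j k v) a' i' j' k' =
  if [&& a' == a, i' == i, j' == j & k' == k] then v else nmem s a' i' j' k'.
Proof. by []. Qed.

Lemma rmem_rset s a i j k v a' i' j' k' :
  rmem (rset s a i j k v) a' i' j' k' =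
  if [&& a' == a, i' == i, j' == j & k' == k] then v else rmem s a' i' j' k'.
Proof. by []. Qed.

Lemma exec_nframe c s a i j k :
  ~~ nwrites a c -> nmem (exec c s) a i j k = nmem s a i j k.
Proof.
elim: c s => //= [b i0 j0 k0 e | c1 IH1 c2 IH2 | e1 e2 c1 IH1 c2 IH2
  | r1 r2 c1 IH1 c2 IH2 | x e c IH] s.
- by rewrite /upd => /negbTE->.
- by rewrite negb_or => /andP[h1 h2]; rewrite IH2 ?IH1.
- by rewrite negb_or => /andP[h1 h2]; case: ifP; rewrite ?IH2 ?IH1.
- by rewrite negb_or => /andP[h1 h2]; case: ifP; rewrite ?IH2 ?IH1.
- rewrite negb_or => /andP[h1 h2].
  elim: (neval s e) => //= m IHm.
  by rewrite IH //= /upd (negbTE h1).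
Qed.

Lemma exec_rframe c s a i j k :
  ~~ rwrites a c -> rmem (exec c s) a i j k = rmem s a i j k.
Proof.
elim: c s => //= [b i0 j0 k0 e | c1 IH1 c2 IH2 | e1 e2 c1 IH1 c2 IH2
  | r1 r2 c1 IH1 c2 IH2 | x e c IH] s.
- by rewrite /upd => /negbTE->.
- by rewrite negb_or => /andP[h1 h2]; rewrite IH2 ?IH1.
- by rewrite negb_or => /andP[h1 h2]; case: ifP; rewrite ?IH2 ?IH1.
- by rewrite negb_or => /andP[h1 h2]; case: ifP; rewrite ?IH2 ?IH1.
- by move=> h; elim: (neval s e) => //= m IHm; rewrite IH.
Qed.

Definition bounded (L : nat) s :=
  forall a i j k, (bitlen (nmem s a i j k) <= L)%N.

Section Bounded.
Variables (L : nat) (s : state R).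
Hypotheses (L_gt0 : (0 < L)%N) (bs : bounded L s).

(** Truncated differences, quotients and remainders never exceed their first operand, so only sums
    and products add up bit-lengths. *)
Lemma bitlen_neval e : (bitlen (neval s e) <= nexp_bits e * L)%N.
Proof.
elim: e => /= [n | a i _ j _ k _ | e1 h1 e2 h2 | e1 h1 e2 h2 | e1 h1 e2 h2
  | e1 h1 e2 h2 | e1 h1 e2 h2].
- by rewrite leq_pmulr.
- by rewrite mul1n.
- by apply: leq_trans (bitlenD _ _) _; rewrite mulnDl leq_add.
- by apply: leq_trans h1; apply/leq_bitlen2/leq_subr.
- by apply: leq_trans (bitlenM _ _) _; rewrite mulnDl leq_add.
- by apply: leq_trans h1; apply/leq_bitlen2/leq_div.
- by apply: leq_trans h1; apply/leq_bitlen2/leq_mod.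
Qed.

Lemma ncost_bound e : (ncost s e <= nexp_steps e * L)%N.
Proof.
elim: e => [n | a i h1 j h2 k h3 | e1 h1 e2 h2 | e1 h1 e2 h2 | e1 h1 e2 h2
  | e1 h1 e2 h2 | e1 h1 e2 h2] /=;
  rewrite [X in (_ <= X)%N]mulnDl; apply: leq_add.
- exact: (bitlen_neval (NConst n)).
- by [].
- exact: (bitlen_neval (NGet a i j k)).
- by rewrite !mulnDl !leq_add.
- exact: (bitlen_neval (NAdd e1 e2)).
- by rewrite mulnDl leq_add.
- exact: (bitlen_neval (NSub e1 e2)).
- by rewrite mulnDl leq_add.
- exact: (bitlen_neval (NMul e1 e2)).
- by rewrite mulnDl leq_add.
- exact: (bitlen_neval (NDiv e1 e2)).
- by rewrite mulnDl leq_add.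
- exact: (bitlen_neval (NMod e1 e2)).
- by rewrite mulnDl leq_add.
Qed.

Lemma rcost_bound r : (rcost s r <= rexp_steps r * L)%N.
Proof.
elim: r => [e | a i j k | r1 h1 r2 h2 | r1 h1 r2 h2] /=; rewrite ?mulSn ?mulnDl.
- by have := ncost_bound e; lia.
- by have := ncost_bound i; have := ncost_bound j; have := ncost_bound k; lia.
- by lia.
- by lia.
Qed.

End Bounded.

Section Runs.
Variables (l : {poly nat}) (z : nat).
Let L := l.[z].
Hypothesis L_gt1 : (1 < L)%N.

(** A Hoare triple bundling correctness, cost and the bound on stored numbers. That bound is both
    assumed and re-established, so it passes through sequences and loops. *)
Definition runs (c : cmd) s (Q : state R -> Prop) :=
  bounded L s ->
  [/\ bounded L (exec c s), Q (exec c s) & (cost c s <= (cmd_steps l c).[z])%N].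

Let L_gt0 : (0 < L)%N. Proof. by rewrite ltnW. Qed.

Lemma bounded_nset s a i j k v :
  bounded L s -> (bitlen v <= L)%N -> bounded L (nset s a i j k v).
Proof. by move=> bs bv a' i' j' k'; rewrite nmem_nset; case: ifP. Qed.

Lemma bitlen_bool (b : bool) : (bitlen b <= L)%N.
Proof. by apply: leq_trans (bitlen_leqS _) _; apply: leq_trans L_gt1; case: b. Qed.

Lemma runs_conseq c s (P Q : state R -> Prop) :
  runs c s P -> (forall s', P s' -> Q s') -> runs c s Q.
Proof. by move=> h hPQ bs; have [h1 h2 h3] := h bs; split; auto. Qed.

Lemma runs_skip s (Q : state R -> Prop) : Q s -> runs Skip s Q.
Proof. by move=> Qs bs; split=> //=; rewrite hornerE. Qed.

Lemma runs_nset a i j k e s (Q : state R -> Prop) :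
  (bitlen (neval s e) <= L)%N ->
  Q (nset s a (neval s i) (neval s j) (neval s k) (neval s e)) ->
  runs (NSet a i j k e) s Q.
Proof.
move=> be Qs bs; split=> //=; first exact: bounded_nset.
rewrite hornerM hornerC -/L -[GRing.mul]/muln.
have h := ncost_bound L_gt0 bs.
by rewrite mulSn !mulnDl -add1n !leq_add.
Qed.

Lemma runs_rset a i j k r s (Q : state R -> Prop) :
  Q (rset s a (neval s i) (neval s j) (neval s k) (reval s r)) ->
  runs (RSet a i j k r) s Q.
Proof.
move=> Qs bs; split=> //=.
rewrite hornerM hornerC -/L -[GRing.mul]/muln.
have h := ncost_bound L_gt0 bs; have h' := rcost_bound L_gt0 bs.
by rewrite mulSn !mulnDl -add1n !leq_add.
Qed.

Lemma runs_seq c1 c2 s (Q : state R -> Prop) :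
  runs c1 s (fun s' => runs c2 s' Q) -> runs (Seq c1 c2) s Q.
Proof.
move=> h bs; have [b1 h2 k1] := h bs; have [b2 q k2] := h2 b1; split=> //=.
by rewrite !hornerE -![GRing.add _ _]/(addn _ _) addn1 ltnS leq_add.
Qed.

Lemma runs_ifR r1 r2 c1 c2 s (Q : state R -> Prop) :
  (reval s r1 <= reval s r2 -> runs c1 s Q) ->
  (reval s r2 < reval s r1 -> runs c2 s Q) ->
  runs (IfR r1 r2 c1 c2) s Q.
Proof.
move=> h1 h2 bs; have h' := rcost_bound L_gt0 bs.
rewrite /= !hornerE -/L -![GRing.add _ _]/(addn _ _) -[GRing.mul]/muln mulSn mulnDl.
by case: leP => h; [have [b q k] := h1 h bs | have [b q k] := h2 h bs]; split=> //;
  have := h' r1; have := h' r2; lia.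
Qed.

(* The invariant may refer to the initial state for the arrays that the loop
   does not write. *)
Lemma runs_for x e c s (I : nat -> state R -> Prop) (Q : state R -> Prop) :
  (neval s e <= L)%N ->
  I 0%N s ->
  (forall i s', (i < neval s e)%N ->
     (forall a i' j k, ~~ nwrites a (For x e c) -> nmem s' a i' j k = nmem s a i' j k) ->
     (forall a i' j k, ~~ rwrites a c -> rmem s' a i' j k = rmem s a i' j k) ->
     I i s' -> runs c (nset s' x 0 0 0 i) (I i.+1)) ->
  (forall s',
     (forall a i' j k, ~~ nwrites a (For x e c) -> nmem s' a i' j k = nmem s a i' j k) ->
     (forall a i' j k, ~~ rwrites a c -> rmem s' a i' j k = rmem s a i' j k) ->
     I (neval s e) s' -> Q s') ->
  runs (For x e c) s Q.
Proof.
set N := neval s e; move=> leN I0 Istep hQ bs.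
pose st i := iteri i (fun i' s' => exec c (nset s' x 0 0 0 i')) s.
have bi i : (i < N)%N -> (bitlen i <= L)%N.
  by move=> ltiN; apply: leq_trans (bitlen_leqS i) _; apply: leq_trans leN.
have nf i a i' j k : ~~ nwrites a (For x e c) -> nmem (st i) a i' j k = nmem s a i' j k.
  rewrite /= negb_or => /andP[h1 h2]; elim: i => //= i IHi.
  by rewrite exec_nframe //= /upd (negbTE h1).
have rf i a i' j k : ~~ rwrites a c -> rmem (st i) a i' j k = rmem s a i' j k.
  by move=> h; elim: i => //= i IHi; rewrite exec_rframe.
have main i : (i <= N)%N -> bounded L (st i) /\ I i (st i).
  elim: i => // i IHi ltiN; have [b1 I1] := IHi (ltnW ltiN).
  have [b2 I2 _] := Istep i (st i) ltiN (nf i) (rf i) I1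
    (bounded_nset _ _ _ _ b1 (bi i ltiN)).
  by [].
have [bN IN] := main N (leqnn N).
split=> //; first exact: (hQ _ (nf N) (rf N) IN).
have -> : (cmd_steps l (For x e c)).[z] =
          ((nexp_steps e).+1 * L + L * (L + (cmd_steps l c).[z]))%N.
  by rewrite /= !hornerE.
rewrite /= -/N mulSn -addnA -add1n; apply: leq_add => //.
apply: leq_add; first exact: ncost_bound.
(* Each of the at most [L] rounds pays at most [L] for the counter and the static bound for the
   body. *)
apply: leq_trans (_ : (\sum_(i < N) (L + (cmd_steps l c).[z]) <= _)%N).
  apply: leq_sum => i _; apply: leq_add; first exact: bi.
  have [b1 I1] := main i (ltnW (ltn_ord i)).
  by have [] := Istep i (st i) (ltn_ord i) (nf i) (rf i) I1
    (bounded_nset _ _ _ _ b1 (bi i (ltn_ord i))).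
by rewrite sum_nat_const card_ord leq_mul2r leN orbT.
Qed.

End Runs.

(** * Tests as arithmetic expressions *)

(** Subtraction is truncated: [1 - (e1 - e2)] is 1 when [e1 <= e2] and 0 otherwise. With 0/1
    arithmetic a whole predicate is evaluated in one assignment. *)
Definition nLe e1 e2 := NSub (NConst 1) (NSub e1 e2).
Definition nNot e := NSub (NConst 1) e.
Definition nIf e e1 e2 := NAdd (NMul e e1) (NMul (nNot e) e2).
Definition nAnd e1 e2 := NMul e1 e2.
Definition nLt e1 e2 := nLe (NAdd e1 (NConst 1)) e2.
Definition nEq e1 e2 := nAnd (nLe e1 e2) (nLe e2 e1).

Lemma neval_nLe s e1 e2 : neval s (nLe e1 e2) = (neval s e1 <= neval s e2)%N.
Proof. by rewrite /=; case: leqP; lia. Qed.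

Lemma neval_nNot s e (b : bool) : neval s e = b -> neval s (nNot e) = ~~ b.
Proof. by move=> /= ->; case: b. Qed.

Lemma neval_nAnd s e1 e2 (b1 b2 : bool) :
  neval s e1 = b1 -> neval s e2 = b2 -> neval s (nAnd e1 e2) = b1 && b2.
Proof. by move=> /= -> ->; rewrite mulnb. Qed.

Lemma neval_nIf s e e1 e2 (b b1 b2 : bool) :
  neval s e = b -> neval s e1 = b1 -> neval s e2 = b2 ->
  neval s (nIf e e1 e2) = if b then b1 else b2.
Proof. by move=> /= -> -> ->; case: b; case: b1; case: b2. Qed.

Lemma neval_nLt s e1 e2 : neval s (nLt e1 e2) = (neval s e1 < neval s e2)%N.
Proof. by rewrite neval_nLe /= addn1. Qed.

Lemma neval_nEq s e1 e2 : neval s (nEq e1 e2) = (neval s e1 == neval s e2).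
Proof. by rewrite (neval_nAnd (neval_nLe _ _ _) (neval_nLe _ _ _)) eqn_leq. Qed.

Lemma neval_rset s a i j k v e : neval (rset s a i j k v) e = neval s e.
Proof.
by elim: e => //= [a' i' -> j' -> k' -> // | ? -> ? -> | ? -> ? -> | ? -> ? ->
  | ? -> ? -> | ? -> ? ->].
Qed.

End Machine.

(** * The graph and its cliques *)

Section Graph.
Context {R : realType}.
Variables (n t m : nat) (memb : nat -> nat -> bool) (T : nat -> nat -> R) (W : R).

Definition du_groups : nat := (n + t.*2.+1)%N.
Definition du_order : nat := (du_groups * n.+1)%N.

(** Here [b] counts groups from the first alliance group on: alliance [b / 2], first or second
    threshold by parity. State [i + 1] of an even group names hero [i]. The nested conditionals
    mirror the machine expression [claimsE]. *)
Definition claims (b st i : nat) : bool :=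
  if (b < t.*2)%N then
    if st == 0%N then false
    else if (0 < b %% 2)%N then memb i (b %/ 2) else st == i.+1
  else false.

(** A first-threshold group may only name a member of its alliance; the last group has no legal
    state 0, so it can only be on. *)
Definition legal (g st : nat) : bool :=
  if (g < n)%N then (st <= m)%N
  else if (g - n < t.*2)%N then
    if st == 0%N then true
    else if (0 < (g - n) %% 2)%N then true else memb (st - 1) ((g - n) %/ 2)
  else (0 < st)%N.

(** One-sided: only hero [g] objects, to a hero in its own slot or, when out of the team, to a claim
    that it is in. [du_adj] asks for both orders. *)
Definition compat (g st g' st' : nat) : bool :=
  if (g < n)%N then
    if (g' < n)%N then if st == 0%N then true else st != st'
    else if st == 0%N then ~~ claims (g' - n) st' g else true
  else true.

(** Vertices are pairs of a group and a state, written in base [n + 1]. *)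
Definition grp (u : nat) : nat := (u %/ n.+1)%N.
Definition sta (u : nat) : nat := (u %% n.+1)%N.

Definition du_adj (u v : nat) : bool :=
  [&& grp u != grp v, legal (grp u) (sta u), legal (grp v) (sta v),
      compat (grp u) (sta u) (grp v) (sta v)
    & compat (grp v) (sta v) (grp u) (sta u)].

(** Null except from a hero to another kind of group, so at most one of the two orientations
    contributes to the symmetric weight. *)
Definition half_weight (u v : nat) : R :=
  let h := (grp u < n <= grp v)%N in
  (if h then W else 0) +
  (if [&& h, 0 < sta u & 0 < sta v]%N then T (grp u) (grp v - n) else 0).

Lemma du_adj_sym (u v : 'I_du_order) : du_adj u v = du_adj v u.
Proof.
by rewrite /du_adj eq_sym; congr andb; case: legal; case: legal; rewrite //= andbC.
Qed.

Lemma du_adj_irr (u : 'I_du_order) : du_adj u u = false.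
Proof. by rewrite /du_adj eqxx. Qed.

Lemma du_weight_sym (u v : 'I_du_order) :
  half_weight u v + half_weight v u = half_weight v u + half_weight u v.
Proof. exact: addrC. Qed.

Definition du_graph : wgraph R :=
  @WGraph R du_order (fun u v => du_adj u v)
    (fun u v => half_weight u v + half_weight v u)
    du_adj_sym du_adj_irr du_weight_sym.

Lemma ltn_grp (u : 'I_du_order) : (grp u < du_groups)%N.
Proof. by rewrite /grp ltn_divLR. Qed.

Lemma ltn_sta u : (sta u <= n)%N.
Proof. by rewrite -ltnS /sta ltn_mod. Qed.

Lemma vertex_eq u v : grp u = grp v -> sta u = sta v -> u = v.
Proof.
by rewrite /grp /sta => h1 h2; rewrite (divn_eq u n.+1) h1 h2 -divn_eq.
Qed.

Lemma vertex_subproof g st :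
  (g < du_groups)%N -> (st <= n)%N -> (g * n.+1 + st < du_order)%N.
Proof. by rewrite /du_order => lg ls; nia. Qed.

Lemma grp_vertex g st : (st <= n)%N -> grp (g * n.+1 + st) = g.
Proof. by move=> ls; rewrite /grp divnMDl // divn_small // addn0. Qed.

Lemma sta_vertex g st : (st <= n)%N -> sta (g * n.+1 + st) = st.
Proof. by move=> ls; rewrite /sta modnMDl modn_small. Qed.

Definition score (x y : nat -> bool) : R :=
  \sum_(i < n) \sum_(b < t.*2.+1) (if x i && y b then T i b else 0).

(** The constraints that a clique meeting every group puts on the groups that are on. Claims have to
    be true, but a true claim need not be made: [y] may be off though the threshold is reached. *)
Definition consistent (x y : nat -> bool) : Prop :=
  [/\ (\sum_(i < n) x i <= m)%N, y t.*2,
      forall j, (j < t)%N -> y j.*2 -> exists2 u, (u < n)%N & memb u j && x u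
    & forall j u, (j < t)%N -> y j.*2.+1 -> (u < n)%N -> memb u j -> x u].

Definition full_weight : R := (n * t.*2.+1)%:R * W.

(** * The weight of a clique, group by group *)

Section Clique.
Variable K : {set 'I_du_order}.

Definition sel (g : nat) : option 'I_du_order := [pick u in K | grp u == g].

Definition sel_sta (g : nat) : nat := oapp (fun u : 'I_du_order => sta u) 0%N (sel g).

(** Hero groups are numbered first, so weight is only carried from a smaller vertex to a larger one;
    the restriction [u < v] in the clique weight can then be dropped. *)
Lemma half_weight_ltn (u v : 'I_du_order) : ~~ (u < v)%N -> half_weight u v = 0.
Proof.
rewrite -leqNgt /half_weight => /(leq_div2r n.+1); rewrite -/(grp u) -/(grp v) => le.
have -> : (grp u < n <= grp v)%N = false by lia.
by rewrite addr0.
Qed.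

Lemma clique_weight_half :
  clique_weight (G := du_graph) K = \sum_(u in K) \sum_(v in K) half_weight u v.
Proof.
rewrite /clique_weight; apply: eq_bigr => u _; rewrite big_mkcondr /=.
apply: eq_bigr => v _; case: ifPn => [lt | ge]; last by rewrite half_weight_ltn.
by rewrite (half_weight_ltn (u := v)) ?addr0 // -leqNgt ltnW.
Qed.

Hypothesis cK : clique (G := du_graph) K.

Lemma clique_adj u v : u \in K -> v \in K -> grp u != grp v -> du_adj u v.
Proof. by move=> Ku Kv ne; apply: cK => //; apply: contraNneq ne => ->. Qed.

Lemma clique_grp_inj u v : u \in K -> v \in K -> grp u = grp v -> u = v.
Proof.
move=> Ku Kv e; apply/eqP; apply: contraT => ne.
by have /= := cK Ku Kv ne; rewrite /du_adj e eqxx.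
Qed.

Lemma sum_sel (F : 'I_du_order -> R) g :
  \sum_(u in K | grp u == g) F u = oapp F 0 (sel g).
Proof.
rewrite /sel; case: pickP => [u /andP[Ku /eqP gu] | none] /=; last first.
  by apply: big_pred0 => u; apply: none.
apply: big_pred1 => v /=; apply/andP/eqP => [[Kv /eqP gv] | ->]; last by rewrite gu.
by apply: clique_grp_inj; rewrite ?gv.
Qed.

Lemma sum_groups (F : 'I_du_order -> R) :
  \sum_(u in K) F u =
  \sum_(i < n) oapp F 0 (sel i) + \sum_(b < t.*2.+1) oapp F 0 (sel (n + b)).
Proof.
rewrite (partition_big (fun u => Ordinal (ltn_grp u)) xpredT) //=.
rewrite big_split_ord; congr +%R; apply: eq_bigr => i _; rewrite -sum_sel;
  by apply: eq_bigl => u; rewrite -val_eqE.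
Qed.

Definition cell (i b : nat) : R :=
  oapp (fun u : 'I_du_order =>
          oapp (fun v : 'I_du_order => half_weight u v) 0 (sel (n + b))) 0 (sel i).

Lemma clique_weight_cells :
  clique_weight (G := du_graph) K = \sum_(i < n) \sum_(b < t.*2.+1) cell i b.
Proof.
rewrite clique_weight_half sum_groups [X in _ + X]big1 ?addr0 => [|b _].
  apply: eq_bigr => i _; rewrite /cell /sel; case: pickP => [u /andP[Ku /eqP gu] | _] /=.
    rewrite sum_groups big1 ?add0r // => i' _; rewrite /sel; case: pickP => //= v.
    case/andP=> _ /eqP gv; rewrite /half_weight gv.
    by rewrite (leqNgt n) ltn_ord andbF addr0.
  by rewrite big1.
rewrite /sel; case: pickP => //= u /andP[_ /eqP gu]; rewrite big1 // => v _.
by rewrite /half_weight gu ltnNge leq_addr addr0.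
Qed.

Lemma selP g u : sel g = Some u -> u \in K /\ grp u = g.
Proof. by rewrite /sel; case: pickP => // v /andP[Kv /eqP gv] [<-]. Qed.

Lemma cell_sel i b : (i < n)%N -> sel i -> sel (n + b) ->
  cell i b = W + (if (0 < sel_sta i)%N && (0 < sel_sta (n + b))%N then T i b else 0).
Proof.
rewrite /cell /sel_sta => lin; case Eu: (sel i) => [u|] // _.
case Ev: (sel (n + b)) => [v|] // _ /=.
have [_ gu] := selP Eu; have [_ gv] := selP Ev.
by rewrite /half_weight gu gv lin leq_addr addKn.
Qed.

Lemma cell_none i b : sel i = None \/ sel (n + b) = None -> cell i b = 0.
Proof. by rewrite /cell => -[->|->] //; case: sel. Qed.

Hypothesis W_big : \sum_(i < n) \sum_(b < t.*2.+1) Num.max 0 (T i b) < W.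

Lemma W_ge0 : 0 <= W.
Proof.
apply/ltW/(le_lt_trans _ W_big); apply: sumr_ge0 => i _; apply: sumr_ge0 => b _.
by rewrite le_max lexx.
Qed.

Lemma cell_le i b : (i < n)%N -> cell i b <= W + Num.max 0 (T i b).
Proof.
move=> lin; have h0 : 0 <= Num.max 0 (T i b) by rewrite le_max lexx.
case Eu: (sel i) => [u|]; last by rewrite cell_none ?addr_ge0 ?W_ge0 //; left.
case Ev: (sel (n + b)) => [v|]; last by rewrite cell_none ?addr_ge0 ?W_ge0 //; right.
rewrite cell_sel ?Eu ?Ev // lerD2l; case: ifP => // _.
by rewrite le_max lexx orbT.
Qed.

(* A missing group loses a whole [W], more than all the bonuses together. *)
Lemma full_clique g :
  full_weight <= clique_weight (G := du_graph) K -> (0 < n)%N ->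
  (g < du_groups)%N -> sel g.
Proof.
move=> fullK n_gt0 ltg; case Eg: (sel g) => // [].
(* A missing hero empties a whole row of cells, any other missing group a whole column; [0 < n]
   provides a row in the second case. *)
have [i0 [b0 cell0]] : exists (i0 : 'I_n) (b0 : 'I_(t.*2.+1)), cell i0 b0 = 0.
  case: (ltnP g n) => [lt | ge].
    by exists (Ordinal lt), ord0; apply: cell_none; left.
  have ltb : (g - n < t.*2.+1)%N by move: ltg; rewrite /du_groups; lia.
  by exists (Ordinal n_gt0), (Ordinal ltb); apply: cell_none; right; rewrite subnKC.
have ge0 (i : 'I_n) (b : 'I_(t.*2.+1)) : 0 <= W + Num.max 0 (T i b) - cell i b.
  by rewrite subr_ge0 cell_le.
(* All slacks are nonnegative and the empty cell has slack at least [W]. Yet the total slack is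
   [full_weight] plus the positive parts of [T] minus the weight of [K], which is below [W]: a
   contradiction. *)
have : W <= \sum_(i < n) \sum_(b < t.*2.+1) (W + Num.max 0 (T i b) - cell i b).
  rewrite (bigD1 i0) //= (bigD1 b0) //= cell0 subr0 -!addrA lerDl.
  rewrite !addr_ge0 ?le_max ?lexx //; first by apply: sumr_ge0.
  by apply: sumr_ge0 => i _; apply: sumr_ge0.
under eq_bigr do rewrite sumrB big_split /= sumr_const card_ord.
rewrite sumrB big_split /= sumr_const card_ord -clique_weight_cells -mulrnA.
rewrite mulnC -mulr_natl -/full_weight.
by move: fullK W_big; lra.
Qed.

Lemma clique_weight_full : (forall g, (g < du_groups)%N -> sel g) ->
  clique_weight (G := du_graph) K =
  full_weight + score (fun i => 0 < sel_sta i)%N (fun b => 0 < sel_sta (n + b))%N.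
Proof.
move=> full; rewrite clique_weight_cells /score.
under eq_bigr => i _.
  under eq_bigr => b _.
    rewrite cell_sel ?full //;
      [over | by rewrite /du_groups ltn_addr | by rewrite ltn_add2l].
  rewrite big_split /= sumr_const card_ord; over.
by rewrite big_split /= sumr_const card_ord -mulrnA mulnC -mulr_natl.
Qed.

Lemma sel_staP g : sel g ->
  exists u : 'I_du_order, [/\ u \in K, grp u = g & sta u = sel_sta g].
Proof.
by rewrite /sel_sta; case E: (sel g) => [u|] // _; have [h1 h2] := selP E; exists u.
Qed.

Hypothesis full : forall g, (g < du_groups)%N -> sel g.

Lemma full_adj g g' : (g < du_groups)%N -> (g' < du_groups)%N -> g != g' ->
  legal g (sel_sta g) && compat g (sel_sta g) g' (sel_sta g').
Proof.
move=> lg lg' ne.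
have [u [Ku gu su]] := sel_staP (full lg).
have [v [Kv gv sv]] := sel_staP (full lg').
have /and5P[_] : du_adj u v by apply: clique_adj; rewrite // gu gv.
by rewrite gu su gv sv => -> _ -> _.
Qed.

Lemma clique_consistent : (0 < n)%N ->
  consistent (fun i => 0 < sel_sta i)%N (fun b => 0 < sel_sta (n + b))%N.
Proof.
move=> n_gt0; have ltG b : (b <= t.*2)%N -> (n + b < du_groups)%N.
  by rewrite /du_groups; lia.
have ltH i : (i < n)%N -> (i < du_groups)%N by rewrite /du_groups; lia.
have neq i b : (i < n)%N -> n + b != i by move=> lt; lia.
(* Legality is read off an adjacency, which needs a second group: hero 0 serves. *)
have leg b : (b <= t.*2)%N -> legal (n + b) (sel_sta (n + b)).
  move=> /ltG lt; have /andP[-> //] := full_adj lt (ltH _ n_gt0) (neq _ b n_gt0).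
(* A claim about hero [i] excludes its state 0. *)
have comp i b : (i < n)%N -> (b <= t.*2)%N -> claims b (sel_sta (n + b)) i ->
    (0 < sel_sta i)%N.
  move=> lti /ltG ltb cl; have := full_adj (ltH _ lti) ltb.
  rewrite eq_sym neq // => /(_ isT) /andP[_].
  rewrite /compat lti ltnNge leq_addr /= addKn cl.
  by case: sel_sta.
split.
(* The slots of the heroes in the team are pairwise distinct numbers among 1, ..., [m]. *)
- have -> : (\sum_(i < n) (0 < sel_sta i) =
      size [seq sel_sta (val i) | i <- enum [pred i : 'I_n | 0 < sel_sta i]])%N.
    rewrite size_map -cardE -sum1_card [RHS]big_mkcond.
    by apply: eq_bigr => i _; rewrite inE; case: leqP.
  rewrite -(size_iota 1 m); apply: uniq_leq_size.
    rewrite map_inj_in_uniq ?enum_uniq // => i j; rewrite !mem_enum !inE => xi xj e.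
    apply/eqP; apply: contraT => ne.
    have /andP[_] := full_adj (ltH _ (ltn_ord i)) (ltH _ (ltn_ord j)) ne.
    by rewrite /compat !ltn_ord e eqxx eqn0Ngt xj.
  move=> p /mapP[i]; rewrite mem_enum inE => xi ->; rewrite mem_iota xi add1n ltnS /=.
  have := full_adj (ltH _ (ltn_ord i)) (ltG 0%N isT).
  by rewrite eq_sym neq // => /(_ isT) /andP[+ _]; rewrite /legal ltn_ord.
- by have := leg _ (leqnn _); rewrite /legal ltnNge leq_addr /= addKn ltnn.
- move=> j ltj; have ltj2 : (j.*2 < t.*2)%N by rewrite ltn_double.
  have := leg _ (ltnW ltj2); rewrite /legal ltnNge leq_addr /= addKn ltj2.
  rewrite modn2 odd_double divn2 doubleK eqn0Ngt => + h; rewrite h /= => mem_u.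
  have ltu : (sel_sta (n + j.*2) - 1 < n)%N.
    have [v [_ _ sv]] := sel_staP (full (ltG _ (ltnW ltj2))).
    by have := ltn_sta v; rewrite sv; lia.
  exists (sel_sta (n + j.*2) - 1)%N; rewrite // mem_u /=.
  apply: (comp _ j.*2) => //; first exact: ltnW.
  by rewrite /claims ltj2 modn2 odd_double eqn0Ngt h /= subn1 prednK.
- move=> j u ltj h ltu mem_u; have ltj2 : (j.*2.+1 < t.*2)%N by lia.
  apply: (comp _ j.*2.+1) => //; first exact: ltnW.
  by rewrite /claims ltj2 modn2 /= odd_double eqn0Ngt h /= divn2 /= uphalf_double.
Qed.

End Clique.

(** * Cliques from a choice of state in every group *)

Section Assignment.
Variable a : nat -> nat.
Hypotheses (a_le : forall g, (g < du_groups)%N -> (a g <= n)%N)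
  (a_legal : forall g, (g < du_groups)%N -> legal g (a g))
  (a_compat : forall g g', (g < du_groups)%N -> (g' < du_groups)%N -> g != g' ->
     compat g (a g) g' (a g')).

Definition assignment_clique : {set 'I_du_order} :=
  [set u : 'I_du_order | sta u == a (grp u)].

Lemma assignment_cliqueP : clique (G := du_graph) assignment_clique.
Proof.
move=> u v; rewrite !inE => /eqP su /eqP sv ne.
have neg : grp u != grp v.
  apply: contraNneq ne => e; apply/eqP/val_inj/vertex_eq; rewrite // su sv e //.
rewrite /= /du_adj neg su sv !a_legal ?a_compat ?ltn_grp //.
by rewrite eq_sym.
Qed.

Lemma assignment_sel g : (g < du_groups)%N ->
  exists2 u, sel assignment_clique g = Some u & sta u = a g.
Proof.
move=> ltg; rewrite /sel; case: pickP => [u | none].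
  by rewrite inE => /andP[/eqP su /eqP gu]; exists u; rewrite // su gu.
have := none (Ordinal (vertex_subproof ltg (a_le ltg))).
by rewrite inE /= grp_vertex ?sta_vertex ?a_le ?eqxx.
Qed.

Lemma assignment_weight :
  clique_weight (G := du_graph) assignment_clique =
  full_weight + score (fun i => 0 < a i)%N (fun b => 0 < a (n + b))%N.
Proof.
rewrite clique_weight_full; first last.
- by move=> g /assignment_sel[u ->].
- exact: assignment_cliqueP.
have e g : (g < du_groups)%N -> sel_sta assignment_clique g = a g.
  by move=> /assignment_sel[u + <-]; rewrite /sel_sta => ->.
congr +%R; apply: eq_bigr => i _; apply: eq_bigr => b _.
by rewrite !e // /du_groups ?ltn_add2l // ltn_addr.
Qed.

End Assignment.

Lemma eq_score x y x' y' :
  (forall i, (i < n)%N -> x i = x' i) -> (forall b, (b < t.*2.+1)%N -> y b = y' b) ->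
  score x y = score x' y'.
Proof.
by move=> ex ey; apply: eq_bigr => i _; apply: eq_bigr => b _; rewrite ex ?ey.
Qed.

(* Heroes of the team are put in slots by order of index. *)
Lemma consistent_clique x y : (0 < n)%N -> consistent x y ->
  exists2 K, clique (G := du_graph) K & clique_weight K = full_weight + score x y.
Proof.
move=> n_gt0 [x_le y_dummy y_even y_odd].
(* The number of team members before [i]. It increases strictly along the team, so the slots
   [rank i + 1] are distinct and at most the size of the team. *)
pose rank i := (\sum_(i' < i) x i')%N.
have rank_lt i j : (i < j)%N -> x i -> (rank i < rank j)%N.
  move=> lt xi; apply: (@leq_trans (rank i.+1)).
    by rewrite /rank big_ord_recr /= xi addn1.
  rewrite /rank -(subnKC lt) big_split_ord /=; exact: leq_addr.
have rank_leS i : (i < n)%N -> x i -> (rank i < \sum_(i < n) x i)%N by exact: rank_lt.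
have rank_n : (\sum_(i < n) x i <= n)%N.
  rewrite -[X in (_ <= X)%N]card_ord -sum1_card; apply: leq_sum => i _; exact: leq_b1.
(* The witness named by the first-threshold group: the first member in the team. *)
pose claimed j := find (fun u => memb u j && x u) (iota 0 n).
have claimedP j : (j < t)%N -> y j.*2 ->
    [/\ (claimed j < n)%N, memb (claimed j) j & x (claimed j)].
  move=> ltj yj; have [u ltu mxu] := y_even j ltj yj.
  have h : has (fun u => memb u j && x u) (iota 0 n).
    by apply/hasP; exists u; rewrite ?mem_iota.
  have lt : (claimed j < n)%N by move: h; rewrite has_find size_iota.
  by have /andP[] := nth_find 0%N h; rewrite nth_iota.
(* Second-threshold groups and the last one make no use of the value of a nonzero state, so 1 will
   do; it is a state because [0 < n]. *)
pose a g := (if g < n then if x g then (rank g).+1 else 0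
  else if y (g - n) && (g - n <= t.*2) then
    if (g - n < t.*2) && ~~ odd (g - n) then (claimed (g - n)./2).+1 else 1
  else 0)%N.
have a_hero g : (g < n)%N -> a g = if x g then (rank g).+1 else 0%N by rewrite /a => ->.
have halfP g : (g - n < t.*2)%N -> ((g - n)./2 < t)%N by lia.
have a_le g : (g < du_groups)%N -> (a g <= n)%N.
  move=> ltg; rewrite /a; case: ifP => [lt | _].
    by case: ifP => // xg; apply: leq_trans rank_n; apply: rank_leS.
  case: ifP => // /andP[yg _]; case: ifP => // /andP[ltt even_g].
  by have [] := claimedP _ (halfP _ ltt); rewrite // even_halfK.
have a_legal g : (g < du_groups)%N -> legal g (a g).
  move=> ltg; rewrite /legal; case: ifP => [lt | nlt].
    rewrite a_hero //; case: ifP => // xg; apply: leq_trans x_le; exact: rank_leS.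
  rewrite /a nlt; case: (ltnP (g - n) t.*2) => [ltt | get] /=.
    rewrite (ltnW ltt) andbT modn2 divn2.
    case yg: (y _) => //=; case og: (odd _) => //=.
    by have [] := claimedP _ (halfP _ ltt); rewrite ?even_halfK ?og // subn1.
  have -> : (g - n = t.*2)%N by move: ltg get; rewrite /du_groups; lia.
  by rewrite y_dummy leqnn.
have a_compat g g' : (g < du_groups)%N -> (g' < du_groups)%N -> g != g' ->
    compat g (a g) g' (a g').
  move=> ltg ltg' ne; rewrite /compat; case: ifP => // lt; case: ifP => lt'.
    rewrite !a_hero //; case: ifP => //; case: ifP => //= xg.
    case: ifP => //= xg' _; rewrite eqSS.
    have /orP[h|h] : (g < g')%N || (g' < g)%N by lia.
      by have := rank_lt _ _ h xg; lia.
    by have := rank_lt _ _ h xg'; lia.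
  case: ifP => //; rewrite a_hero //; case: ifP => // xg _.
  rewrite /claims; case: ifP => // ltt; rewrite /a lt' (ltnW ltt) andbT ltt /=.
  case yg: (y _) => //=; rewrite modn2 divn2; case og: (odd _) => //=.
    (* An odd group that is on has all its members in the team, against [x g] being false; an even
       one, treated next, names a hero of the team, hence not [g]. *)
    apply/negP => mem_g; have ej : (g' - n = (g' - n)./2.*2.+1)%N.
      by rewrite -[LHS]odd_double_half og.
    by have := y_odd _ g (halfP _ ltt); rewrite -ej yg xg => /(_ isT lt mem_g).
  have [] := claimedP _ (halfP _ ltt); first by rewrite even_halfK ?og.
  by move=> _ _ xc; apply: contraFN xg; rewrite eqSS => /eqP <-.
exists (assignment_clique a); first exact: assignment_cliqueP.
rewrite assignment_weight //; congr +%R; apply: eq_score => [i lti | b ltb].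
  by rewrite a_hero //; case: (x i).
have leb : (b <= t.*2)%N by rewrite -ltnS.
rewrite /a [(n + b < n)%N]ltnNge leq_addr /= addKn leb andbT.
by case: (y b) => //=; case: ifP.
Qed.

(** The empty team with every claim off. Through [consistent_clique] it gives a clique of weight
    [full_weight], the level that [full_clique] asks for. *)
Lemma score_ge0_idle : exists x y, consistent x y /\ score x y = 0.
Proof.
exists xpred0, (fun b => b == t.*2); split.
  split=> //.
  - by rewrite big1.
  - by move=> j ltj; rewrite eqn_leq !leq_double => /andP[_]; lia.
  - by move=> j u ltj; lia.
by rewrite /score big1 // => i _; rewrite big1.
Qed.

(** On cliques that meet every group the weight is a constant plus the score, and every consistent
    pair comes from a clique, so maximality passes to the score. *)
Lemma max_clique_score K : max_clique (G := du_graph) K -> (0 < n)%N ->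
  \sum_(i < n) \sum_(b < t.*2.+1) Num.max 0 (T i b) < W ->
  let x i := (0 < sel_sta K i)%N in let y b := (0 < sel_sta K (n + b))%N in
  [/\ forall g, (g < du_groups)%N -> sel K g, consistent x y
    & forall x' y', consistent x' y' -> score x' y' <= score x y].
Proof.
move=> [cK maxK] n_gt0 W_big x y.
have le_K x' y' : consistent x' y' -> full_weight + score x' y' <= clique_weight K.
  by move=> /(consistent_clique n_gt0)[K' cK' <-]; apply: maxK.
have full g : (g < du_groups)%N -> sel K g.
  apply: full_clique => //; have [x' [y' [c s0]]] := score_ge0_idle.
  by have := le_K _ _ c; rewrite s0 addr0.
split=> //; first exact: clique_consistent.
by move=> x' y' /le_K; rewrite clique_weight_full // lerD2l.
Qed.

End Graph.

(** * The programs *)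

(** Scalars 10, 11 and 12 serve as loop counters, outside the arrays of the input and output
    conventions. *)
Definition scalar (a : nat) : nexp := NGet a (NConst 0) (NConst 0) (NConst 0).
Definition nHeroes := scalar 0.
Definition nTwice := NMul (NConst 2) (scalar 2).
Definition nStates := NAdd nHeroes (NConst 1).
Definition nOrder := NMul (NAdd nHeroes (NAdd nTwice (NConst 1))) nStates.

Definition claimsE (b st i : nexp) : nexp :=
  nIf (nLt b nTwice)
    (nIf (nEq st (NConst 0)) (NConst 0)
       (nIf (nLt (NConst 0) (NMod b (NConst 2)))
          (NGet 4 i (NDiv b (NConst 2)) (NConst 0))
          (nEq st (NAdd i (NConst 1)))))
    (NConst 0).

Definition legalE (g st : nexp) : nexp :=
  nIf (nLt g nHeroes) (nLe st (scalar 1))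
    (nIf (nLt (NSub g nHeroes) nTwice)
       (nIf (nEq st (NConst 0)) (NConst 1)
          (nIf (nLt (NConst 0) (NMod (NSub g nHeroes) (NConst 2))) (NConst 1)
             (NGet 4 (NSub st (NConst 1)) (NDiv (NSub g nHeroes) (NConst 2)) (NConst 0))))
       (nLt (NConst 0) st)).

Definition compatE (g st g' st' : nexp) : nexp :=
  nIf (nLt g nHeroes)
    (nIf (nLt g' nHeroes)
       (nIf (nEq st (NConst 0)) (NConst 1) (nNot (nEq st st')))
       (nIf (nEq st (NConst 0)) (nNot (claimsE (NSub g' nHeroes) st' g)) (NConst 1)))
    (NConst 1).

Definition grpE (u : nexp) := NDiv u nStates.
Definition staE (u : nexp) := NMod u nStates.

Definition adjE (u v : nexp) : nexp :=
  nAnd (nNot (nEq (grpE u) (grpE v)))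
    (nAnd (legalE (grpE u) (staE u))
       (nAnd (legalE (grpE v) (staE v))
          (nAnd (compatE (grpE u) (staE u) (grpE v) (staE v))
             (compatE (grpE v) (staE v) (grpE u) (staE u))))).

(* The bonuses are tabulated in the cells (i, b, 1) of the real array 4, and
   the constant [W] in the cell (1, 0, 0) of the real array 5; the cells with
   a 0 in place of the 1 remain null, so that the last index acts as a test. *)
Definition halfE (u v : nexp) : rexp :=
  let h := nAnd (nLt (grpE u) nHeroes) (nLe nHeroes (grpE v)) in
  RAdd (RGet 5 h (NConst 0) (NConst 0))
    (RGet 4 (grpE u) (NSub (grpE v) nHeroes)
       (nAnd h (nAnd (nLt (NConst 0) (staE u)) (nLt (NConst 0) (staE v))))).

Definition add_to_W (r : rexp) : cmd :=
  RSet 5 (NConst 1) (NConst 0) (NConst 0)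
    (RAdd (RGet 5 (NConst 1) (NConst 0) (NConst 0)) r).

Definition strengthE := RGet 0 (scalar 10) (NConst 0) (NConst 0).
Definition bonusE :=
  RGet 1 (scalar 10) (NDiv (scalar 11) (NConst 2)) (NMod (scalar 11) (NConst 2)).

(** A negative bonus leaves its cell at the initial 0, which performs the truncation. *)
Definition table_bonuses : cmd :=
  For 11 nTwice
    (IfR (RNat (NConst 0)) bonusE
       (Seq (RSet 4 (scalar 10) (scalar 11) (NConst 1) bonusE) (add_to_W bonusE))
       Skip).

(** Strengths go untruncated into column [2t], since a hero in the team brings its strength whatever
    the sign; only the positive part enters [W]. *)
Definition fill_table : cmd :=
  For 10 nHeroes
    (Seq (RSet 4 (scalar 10) nTwice (NConst 1) strengthE)
    (Seq (IfR (RNat (NConst 0)) strengthE (add_to_W strengthE) Skip)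
         table_bonuses)).

Definition fill_row : cmd :=
  For 11 nOrder
    (Seq (NSet 6 (scalar 10) (scalar 11) (NConst 0) (adjE (scalar 10) (scalar 11)))
         (RSet 3 (scalar 10) (scalar 11) (NConst 0)
            (RAdd (halfE (scalar 10) (scalar 11)) (halfE (scalar 11) (scalar 10))))).

Definition fill_graph : cmd := For 10 nOrder fill_row.

(** [W] starts at 1 so as to be strictly larger than the sum of the positive parts. *)
Definition reduce_cmd : cmd :=
  Seq (NSet 5 (NConst 0) (NConst 0) (NConst 0) nOrder)
  (Seq (RSet 5 (NConst 1) (NConst 0) (NConst 0) (RNat (NConst 1)))
  (Seq fill_table fill_graph)).

(** [g * (n + 1)] is the vertex of state 0 in group [g]. *)
Definition cliqueE (g : nexp) := NGet 7 (NMul g nStates) (NConst 0) (NConst 0).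

(** Two thresholds suffice for alliances of two heroes. A negative bonus stays inactive, in
    accordance with the truncation. *)
Definition decode_alliance : cmd :=
  For 12 (NConst 2)
    (IfR (RNat (NConst 0)) (RGet 1 (scalar 10) (scalar 11) (scalar 12))
       (NSet 9 (scalar 10) (scalar 11) (scalar 12)
          (nAnd (nNot (cliqueE (scalar 10)))
             (nNot (cliqueE (NAdd nHeroes
                (NAdd (NMul (NConst 2) (scalar 11)) (scalar 12)))))))
       Skip).

Definition decode_hero : cmd := For 11 (scalar 2) decode_alliance.

Definition decode_cmd : cmd :=
  For 10 nHeroes
    (Seq (NSet 8 (scalar 10) (NConst 0) (NConst 0) (nNot (cliqueE (scalar 10))))
         decode_hero).

(** * Correctness and cost of the programs *)

Section Programs.
Context {R : realType}.
Variables (n t m : nat) (memb : nat -> nat -> bool).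
Variables (str : nat -> R) (bon : nat -> nat -> nat -> R).
Implicit Types s : state R.

Definition table (i b : nat) : R :=
  if (b < t.*2)%N then Num.max 0 (bon i (b %/ 2) (b %% 2)) else str i.

Lemma table_dummy i : table i t.*2 = str i.
Proof. by rewrite /table ltnn. Qed.

Definition bigW : R := 1 + \sum_(i < n) \sum_(b < t.*2.+1) Num.max 0 (table i b).

Definition input_ok s :=
  [/\ nmem s 0 0 0 0 = n, nmem s 1 0 0 0 = m, nmem s 2 0 0 0 = t
    & forall i j, nmem s 4 i j 0 = memb i j].

Definition reals_ok s :=
  (forall i, rmem s 0 i 0 0 = str i) /\ (forall i j k, rmem s 1 i j k = bon i j k).

(** Columns beyond [2t] are never filled while [table] equals [str] there, hence the bound on
    [b]. *)
Definition tables_ok s :=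
  [/\ forall i b k, (b <= t.*2)%N ->
        rmem s 4 i b k = if (k == 1)%N && (i < n)%N then table i b else 0,
      rmem s 5 0 0 0 = 0 & rmem s 5 1 0 0 = bigW].

Lemma neval_nTwice s : input_ok s -> neval s nTwice = t.*2.
Proof. by case=> _ _ /= -> _; rewrite mul2n. Qed.

Lemma neval_nHeroes s : input_ok s -> neval s nHeroes = n.
Proof. by case=> /= ->. Qed.

Lemma neval_nStates s : input_ok s -> neval s nStates = n.+1.
Proof. by case=> /= -> _ _ _; rewrite addn1. Qed.

Lemma neval_nOrder s : input_ok s -> neval s nOrder = du_order n t.
Proof.
move=> ok; have /= -> := neval_nHeroes ok; have /= -> := neval_nTwice ok.
by rewrite !addn1.
Qed.

Section Exprs.
Variable s : state R.
Hypothesis ok : input_ok s.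

Lemma neval_claimsE b st i :
  neval s (claimsE b st i) = claims t memb (neval s b) (neval s st) (neval s i).
Proof.
have [_ _ _ okm] := ok.
rewrite /claims /claimsE; apply: neval_nIf => //.
  by rewrite neval_nLt neval_nTwice.
apply: (@neval_nIf _ _ _ _ _ _ false); [exact: neval_nEq | by [] |].
by apply: neval_nIf; [exact: neval_nLt | exact: okm | rewrite neval_nEq /= addn1].
Qed.

Lemma neval_legalE g st :
  neval s (legalE g st) = legal n t m memb (neval s g) (neval s st).
Proof.
have [okn okt _ okm] := ok.
rewrite /legal /legalE; apply: neval_nIf.
- by rewrite neval_nLt neval_nHeroes.
- by rewrite neval_nLe /= okt.
apply: neval_nIf; [by rewrite neval_nLt neval_nTwice //= okn | | exact: neval_nLt].
apply: (@neval_nIf _ _ _ _ _ _ true); [exact: neval_nEq | by [] |].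
apply: (@neval_nIf _ _ _ _ _ _ true); [by rewrite neval_nLt /= okn | by [] |].
by rewrite /= okm okn.
Qed.

Lemma neval_compatE g st g' st' :
  neval s (compatE g st g' st') =
  compat n t memb (neval s g) (neval s st) (neval s g') (neval s st').
Proof.
have [okn _ _ _] := ok.
rewrite /compat /compatE; apply: (@neval_nIf _ _ _ _ _ _ _ true) => //.
  by rewrite neval_nLt neval_nHeroes.
apply: neval_nIf; first by rewrite neval_nLt neval_nHeroes.
  by apply: (@neval_nIf _ _ _ _ _ _ true);
    [exact: neval_nEq | | exact/neval_nNot/neval_nEq].
apply: (@neval_nIf _ _ _ _ _ _ _ true); [exact: neval_nEq | | by []].
by apply: neval_nNot; rewrite neval_claimsE /= okn.
Qed.

Lemma neval_grpE u : neval s (grpE u) = grp n (neval s u).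
Proof. by rewrite /= ; have [-> _ _ _] := ok; rewrite addn1. Qed.

Lemma neval_staE u : neval s (staE u) = sta n (neval s u).
Proof. by rewrite /= ; have [-> _ _ _] := ok; rewrite addn1. Qed.

Lemma neval_adjE u v :
  neval s (adjE u v) = du_adj n t m memb (neval s u) (neval s v).
Proof.
rewrite /adjE /du_adj; do 4?apply: neval_nAnd;
  rewrite ?neval_legalE ?neval_compatE ?neval_grpE ?neval_staE //.
by apply: neval_nNot; rewrite neval_nEq !neval_grpE.
Qed.

Lemma reval_halfE u v : tables_ok s -> (neval s v < du_order n t)%N ->
  reval s (halfE u v) = half_weight n table bigW (neval s u) (neval s v).
Proof.
move=> [ok4 ok50 ok51] ltv.
have eh : neval s (nAnd (nLt (grpE u) nHeroes) (nLe nHeroes (grpE v))) =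
    (grp n (neval s u) < n <= grp n (neval s v))%N.
  by apply: neval_nAnd; rewrite ?neval_nLt ?neval_nLe neval_nHeroes // neval_grpE.
have e0 w : neval s (nLt (NConst 0) (staE w)) = (0 < sta n (neval s w))%N.
  by rewrite neval_nLt neval_staE.
rewrite /half_weight /halfE /reval eh (neval_nAnd eh (neval_nAnd (e0 u) (e0 v))).
congr +%R; first by case: (_ && _) => /=.
have eb : neval s (NSub (grpE v) nHeroes) = (grp n (neval s v) - n)%N.
  by rewrite -neval_grpE /=; have [-> _ _ _] := ok.
rewrite eb neval_grpE ok4; last first.
  by have := @ltn_grp n t (Ordinal ltv); rewrite /= /du_groups; lia.
case: (ltnP (grp n _) n) => _; last by rewrite andbF.
by case: (n <= _)%N => //=; do 2?case: (0 < sta n _)%N.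
Qed.

End Exprs.

Lemma eq_input_ok s s' :
  (forall a i j k, (a < 5)%N -> nmem s' a i j k = nmem s a i j k) ->
  input_ok s -> input_ok s'.
Proof. by move=> e [h0 h1 h2 h3]; split; rewrite ?e // => i j; rewrite e. Qed.

Variables (l : {poly nat}) (z : nat).
Hypotheses (L_gt1 : (1 < l.[z])%N) (order_lt : (du_order n t < l.[z])%N).

Let order_le : (du_order n t <= l.[z])%N.
Proof. exact: ltnW. Qed.

Let n_le : (n <= l.[z])%N.
Proof. by move: order_lt; rewrite /du_order /du_groups; nia. Qed.

Let t2_le : (t.*2 <= l.[z])%N.
Proof. by move: order_lt; rewrite /du_order /du_groups; nia. Qed.

(** Column [2t] and the share of the strength in [W] are already in place when the loop over the
    bonuses of hero [i] starts. *)
Definition table_upto (i b : nat) s :=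
  [/\ forall i' b' k, (b' <= t.*2)%N ->
        rmem s 4 i' b' k =
        if (k == 1)%N && ((i' < i) || (i' == i) && ((b' < b) || (b' == t.*2)))%N
        then table i' b' else 0,
      rmem s 5 0 0 0 = 0
    & rmem s 5 1 0 0 =
      1 + \sum_(i' < i) \sum_(b' < t.*2.+1) Num.max 0 (table i' b') +
      Num.max 0 (str i) + \sum_(b' < b) Num.max 0 (table i b')].

Definition table_upto_hero (i : nat) s :=
  [/\ forall i' b' k, (b' <= t.*2)%N ->
        rmem s 4 i' b' k = if (k == 1)%N && (i' < i)%N then table i' b' else 0,
      rmem s 5 0 0 0 = 0
    & rmem s 5 1 0 0 =
      1 + \sum_(i' < i) \sum_(b' < t.*2.+1) Num.max 0 (table i' b')].

Lemma runs_table_bonuses i s : input_ok s -> reals_ok s -> nmem s 10 0 0 0 = i ->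
  table_upto i 0 s -> runs l z table_bonuses s (table_upto_hero i.+1).
Proof.
move=> ok [okr0 okr1] ei tab0.
apply: (runs_for L_gt1 (I := table_upto i)); rewrite ?neval_nTwice //; last first.
  move=> s' _ _ [h4 h50 h51]; split=> //.
    move=> i' b' k leb; rewrite h4 // [((b' < _) || _)%N]orbC -leq_eqVlt leb andbT.
    by rewrite orbC -leq_eqVlt -ltnS.
  rewrite h51 big_ord_recr /= [X in _ = _ + (_ + X)]big_ord_recr /=.
  by rewrite table_dummy; lra.
move=> b s' ltb nf rf [h4 h50 h51].
set s1 := nset s' 11 0 0 0 b.
have e10 : neval s1 (scalar 10) = i by rewrite /= /upd /= nf.
have e11 : neval s1 (scalar 11) = b by [].
have ebon : reval s1 bonusE = bon i (b %/ 2) (b %% 2).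
  by rewrite /bonusE /= /upd /= nf // ei rf.
have tabb : table i b = Num.max 0 (bon i (b %/ 2) (b %% 2)) by rewrite /table ltb.
apply: (runs_ifR L_gt1); rewrite ebon [reval _ (RNat _)]/= => hb.
- apply: runs_seq; apply: (runs_rset L_gt1); apply: (runs_rset L_gt1).
  rewrite !neval_rset e10 e11 ebon.
  set s2 := rset s1 _ _ _ _ _.
  have -> : reval s2 (RAdd (RGet 5 (NConst 1) (NConst 0) (NConst 0)) bonusE) =
      rmem s' 5 1 0 0 + bon i (b %/ 2) (b %% 2).
    by rewrite -ebon.
  have tabE : table i b = bon i (b %/ 2) (b %% 2) by rewrite tabb; apply/max_idPr.
  split.
  + move=> i' b' k leb; rewrite !rmem_rset /= h4 //.
    case: (k =P 1%N) => _; rewrite ?andbF //=.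
    case: (i' =P i) => [->|_] //=; case: (b' =P b) => [->|/eqP/negbTE nb] /=.
      by rewrite ltnSn orbT tabE.
    by rewrite ltnS [(b' <= b)%N]leq_eqVlt nb.
  + by [].
  + by rewrite rmem_rset /= h51 big_ord_recr /= tabE (max_idPr hb) addrA.
- apply: runs_skip.
  have tabE : table i b = 0 by rewrite tabb; apply/max_idPl/ltW.
  split=> //.
  + move=> i' b' k leb; rewrite [rmem _]/= h4 // ltnS [(b' <= b)%N]leq_eqVlt.
    case: (i' =P i) => [->|_] //=; case: (b' =P b) => [->|_] //=.
    by rewrite tabE !if_same.
  + by rewrite [rmem _]/= h51 big_ord_recr /= tabE maxxx addr0.
Qed.

Lemma runs_fill_table s : input_ok s -> reals_ok s -> table_upto_hero 0 s ->
  runs l z fill_table s tables_ok.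
Proof.
move=> ok okr tab0.
apply: (runs_for L_gt1 (I := table_upto_hero)); rewrite ?neval_nHeroes //; last first.
move=> i s' lti nf rf [h4 h50 h51].
set s1 := nset s' 10 0 0 0 i.
have ok1 : input_ok s1.
  by apply: eq_input_ok ok => -[|[|[|[|[|]]]]] // i' j k _; rewrite /= /upd /= nf.
have okr1 : reals_ok s1 by case: okr => r0 r1; split=> *; rewrite /= rf.
have estr : reval s1 strengthE = str i by rewrite /strengthE /= rf //; case: okr.
have e10 : neval s1 (scalar 10) = i by [].
apply: runs_seq; apply: (runs_rset L_gt1).
rewrite (neval_nTwice ok1) e10 estr [neval _ (NConst _)]/=.
set s2 := rset s1 _ _ _ _ _.
have estr2 : reval s2 strengthE = str i by rewrite -estr.
(* Both outcomes of the sign test lead here: [W] has grown by the positive part of the strength. *)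
have main s3 : (forall a i' j k, nmem s3 a i' j k = nmem s1 a i' j k) ->
    (forall a i' j k, a != 5%N -> rmem s3 a i' j k = rmem s2 a i' j k) ->
    rmem s3 5 0 0 0 = 0 ->
    rmem s3 5 1 0 0 = rmem s' 5 1 0 0 + Num.max 0 (str i) ->
    runs l z table_bonuses s3 (table_upto_hero i.+1).
  move=> nf3 rf3 h50' h51'; apply: (@runs_table_bonuses i).
  - by apply: eq_input_ok ok1 => *; rewrite nf3.
  - by case: okr1 => r0 r1; split=> *; rewrite rf3 // /s2 rmem_rset /= ?r0 ?r1.
  - by rewrite nf3.
  split=> //; last by rewrite h51' h51 big_ord0 addr0.
  move=> i' b' k leb; rewrite rf3 // /s2 rmem_rset /= h4 //.
  case: (k =P 1%N) => _; rewrite ?andbF //=.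
  case: (i' =P i) => [->|_] /=; last by rewrite orbF.
  by rewrite andbT ltnn; case: eqP => [->|_] //; rewrite table_dummy.
apply: runs_seq; apply: (runs_ifR L_gt1); rewrite estr2 [reval _ (RNat _)]/= => hs.
- apply: (runs_rset L_gt1); apply: main => //.
  + by move=> a i' j k /negbTE na; rewrite rmem_rset na.
  + have -> : reval s2 (RAdd (RGet 5 (NConst 1) (NConst 0) (NConst 0)) strengthE) =
        rmem s' 5 1 0 0 + str i by rewrite -estr2.
    by rewrite rmem_rset /= max_r.
- by apply: runs_skip; apply: main; rewrite // max_l ?addr0 // ltW.
Qed.

Definition rows_upto (u v : nat) s :=
  forall u' v', (u' < du_order n t)%N -> (v' < du_order n t)%N ->
  ((u' < u) || (u' == u) && (v' < v))%N ->
  nmem s 6 u' v' 0 = du_adj n t m memb u' v' /\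
  rmem s 3 u' v' 0 = half_weight n table bigW u' v' + half_weight n table bigW v' u'.

Lemma runs_fill_row u s : input_ok s -> tables_ok s -> nmem s 10 0 0 0 = u ->
  (u < du_order n t)%N -> rows_upto u 0 s ->
  runs l z fill_row s (rows_upto u.+1 0).
Proof.
move=> ok okt eu ltu row0.
apply: (runs_for L_gt1 (I := rows_upto u)); rewrite ?neval_nOrder //; last first.
  move=> s' _ _ rows u' v' ltu' ltv'; rewrite ltn0 andbF orbF ltnS leq_eqVlt orbC => le.
  by apply: rows; rewrite // ltv' andbT.
move=> v s' ltv nf rf rows.
set s1 := nset s' 11 0 0 0 v.
have e10 : neval s1 (scalar 10) = u by rewrite /= /upd /= nf.
have e11 : neval s1 (scalar 11) = v by [].
have ok1 : input_ok s1.
  by apply: eq_input_ok ok => -[|[|[|[|[|]]]]] // i' j k _; rewrite /= /upd /= nf.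
apply: runs_seq; apply: (runs_nset L_gt1).
  by rewrite neval_adjE // bitlen_bool.
rewrite neval_adjE // e10 e11; set s2 := nset s1 _ _ _ _ _.
apply: (runs_rset L_gt1).
have e10' : neval s2 (scalar 10) = u by [].
have e11' : neval s2 (scalar 11) = v by [].
have ok2 : input_ok s2.
  by apply: eq_input_ok ok1 => -[|[|[|[|[|]]]]].
have okt2 : tables_ok s2.
  by case: okt => h4 h50 h51; split=> *; rewrite [rmem _]/= rf // h4.
have -> : reval s2 (RAdd (halfE (scalar 10) (scalar 11))
                          (halfE (scalar 11) (scalar 10))) =
    half_weight n table bigW u v + half_weight n table bigW v u.
  rewrite [LHS](_ : _ = reval s2 (halfE (scalar 10) (scalar 11)) +
                        reval s2 (halfE (scalar 11) (scalar 10))) //.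
  by rewrite !reval_halfE ?e10' ?e11'.
rewrite e10' e11' => u' v' ltu' ltv' le.
rewrite rmem_rset /= /upd /= !andbT.
case: (u' =P u) le => [->|_] /=; last by rewrite orbF => le; apply: rows; rewrite ?le.
rewrite ltnn /= ltnS leq_eqVlt; case: (v' =P v) => [->|_] //= ltv''.
by apply: rows; rewrite // eqxx ltv'' orbT.
Qed.

Lemma runs_fill_graph s : input_ok s -> tables_ok s ->
  runs l z fill_graph s (rows_upto (du_order n t) 0).
Proof.
move=> ok okt.
apply: (runs_for L_gt1 (I := fun u => rows_upto u 0)); rewrite ?neval_nOrder //.
- by move=> u' v' _ _; rewrite ltn0 andbF.
move=> u s' ltu nf rf rows; apply: runs_fill_row => //.
- by apply: eq_input_ok ok => -[|[|[|[|[|]]]]] // i' j k _; rewrite /= /upd /= nf.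
- by case: okt => h4 h50 h51; split=> *; rewrite [rmem _]/= rf // h4.
Qed.

Lemma runs_reduce s : input_ok s -> reals_ok s ->
  (forall a i j k, (2 < a)%N -> rmem s a i j k = 0) ->
  runs l z reduce_cmd s (fun s' => nmem s' 5 0 0 0 = du_order n t /\
    rows_upto (du_order n t) 0 s').
Proof.
move=> ok okr zero.
apply: runs_seq; apply: (runs_nset L_gt1); rewrite neval_nOrder //.
  (* A number strictly below [L] has at most [L] bits. *)
  exact: leq_trans (bitlen_leqS _) order_lt.
apply: runs_seq; apply: (runs_rset L_gt1); set s1 := rset _ _ _ _ _ _.
have ok1 : input_ok s1 by apply: eq_input_ok ok => -[|[|[|[|[|]]]]].
have okr1 : reals_ok s1 by case: okr => r0 r1; split.
have n5 : nmem s1 5 0 0 0 = du_order n t by [].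
apply: runs_seq; apply: (@runs_conseq _ _ _ _ _
    (fun s2 => [/\ input_ok s2, tables_ok s2 & nmem s2 5 0 0 0 = du_order n t])).
  move=> bs1; have [|b2 t2 k2] := @runs_fill_table s1 ok1 okr1 _ bs1.
    split=> [i' b' k _ | | ].
    - by rewrite ltn0 andbF -(zero 4%N i' b' k).
    - by rewrite -(zero 5%N 0%N 0%N 0%N).
    - by rewrite big_ord0 addr0.
  split=> //; split=> //; last by rewrite exec_nframe.
  by apply: eq_input_ok ok1 => -[|[|[|[|[|]]]]] // i' j k _; rewrite exec_nframe.
move=> s2 [ok2 t2 n2] bs2; have [b3 h3 k3] := @runs_fill_graph s2 ok2 t2 bs2.
by split=> //; split=> //; rewrite exec_nframe.
Qed.

(** * Decoding a clique *)

Section Decode.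
Variable clq : nat -> bool.

Definition switched_on (g : nat) : bool := ~~ clq (g * n.+1).

Definition clique_ok s := forall k, nmem s 7 k 0 0 = clq k.

Definition activated (i j r : nat) : bool :=
  [&& switched_on i, switched_on (n + (j.*2 + r)) & 0 <= bon i j r].

Lemma neval_cliqueE s g : input_ok s -> clique_ok s ->
  neval s (nNot (cliqueE g)) = switched_on (neval s g).
Proof.
move=> ok okc; apply: neval_nNot.
by rewrite -okc -(neval_nStates ok).
Qed.

(** Thanks to [j' < t], the end of row [i] and the beginning of row [i + 1] are the same
    condition. *)
Definition active_upto (i j r : nat) s :=
  forall i' j' r', (j' < t)%N ->
  nmem s 9 i' j' r' =
  (if ((i' < i) || (i' == i) && ((j' < j) || (j' == j) && (r' < r))) && (r' < 2)
   then activated i' j' r' else false)%N.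

Lemma eq_clique_ok s s' :
  (forall i j k, nmem s' 7 i j k = nmem s 7 i j k) -> clique_ok s -> clique_ok s'.
Proof. by move=> e h k; rewrite e. Qed.

Lemma runs_decode_alliance i j s : input_ok s -> reals_ok s -> clique_ok s ->
  nmem s 10 0 0 0 = i -> nmem s 11 0 0 0 = j -> active_upto i j 0 s ->
  runs l z decode_alliance s (active_upto i j.+1 0).
Proof.
move=> ok okr okc ei ej act0.
apply: (runs_for L_gt1 (I := active_upto i j)) => //; last first.
  move=> s' _ _ act i' j' r' ltj'; rewrite act // [neval _ _]/=.
  case: (ltnP r' 2) => _; last by rewrite !andbF.
  rewrite !andbT ltn0 andbF orbF [(j' < j.+1)%N]ltnS [(j' <= j)%N]leq_eqVlt.
  by rewrite [((j' == j) || _)%N]orbC.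
move=> r s' ltr nf rf act; set s1 := nset s' 12 0 0 0 r.
have e10 : neval s1 (scalar 10) = i by rewrite /= /upd /= nf.
have e11 : neval s1 (scalar 11) = j by rewrite /= /upd /= nf.
have e12 : neval s1 (scalar 12) = r by [].
have ok1 : input_ok s1.
  by apply: eq_input_ok ok => -[|[|[|[|[|]]]]] // i' j' k _; rewrite /= /upd /= nf.
have okc1 : clique_ok s1.
  by apply: eq_clique_ok okc => i' j' k; rewrite /= /upd /= nf.
apply: (@runs_conseq _ _ _ _ _ (fun s2 => forall i' j' r', (j' < t)%N ->
    nmem s2 9 i' j' r' = if [&& i' == i, j' == j & r' == r]
      then nat_of_bool (activated i j r) else nmem s1 9 i' j' r')); last first.
  move=> s2 h i' j' r' ltj'; rewrite h // [nmem s1 _ _ _ _]/= /upd /= act //.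
  rewrite [(r' < r.+1)%N]ltnS [(r' <= r)%N]leq_eqVlt.
  case: (i' =P i) => [->|_] //=; case: (j' =P j) => [->|_] //=.
  by case: (r' =P r) => [->|_] //=; rewrite (ltr : (r < 2)%N) !orbT.
have ebon : reval s1 (RGet 1 (scalar 10) (scalar 11) (scalar 12)) = bon i j r.
  rewrite -[LHS]/(rmem s' 1 (neval s1 (scalar 10)) (neval s1 (scalar 11))
                  (neval s1 (scalar 12))).
  by rewrite e10 e11 e12 rf //; case: okr.
set e := nAnd _ _.
have ee : neval s1 e = switched_on i && switched_on (n + (j.*2 + r)).
  apply: neval_nAnd; rewrite neval_cliqueE // ?e10 //.
  have -> // : neval s1 (NAdd nHeroes (NAdd (NMul (NConst 2) (scalar 11)) (scalar 12))) =
    (n + (j.*2 + r))%N.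
  rewrite -[LHS]/(neval s1 nHeroes + (2 * neval s1 (scalar 11) + neval s1 (scalar 12)))%N.
  by rewrite neval_nHeroes // e11 e12 mul2n.
apply: (runs_ifR L_gt1); rewrite ebon [reval _ (RNat _)]/= => hb.
- apply: (runs_nset L_gt1); rewrite ee; first exact: bitlen_bool.
  by rewrite e10 e11 e12 => i' j' r' ltj'; rewrite nmem_nset /= /activated hb !andbT.
- apply: runs_skip => i' j' r' ltj'; case: ifP => // /and3P[/eqP ei' /eqP ej' /eqP er'].
  (* Nothing is written: the invariant already gives 0 at a cell not yet visited. *)
  rewrite [LHS]/= /upd /= act // ei' ej' er' /activated [0 <= _]leNgt hb !andbF.
  by rewrite !ltnn !andbF orbF.
Qed.

Lemma runs_decode_hero i s : input_ok s -> reals_ok s -> clique_ok s ->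
  nmem s 10 0 0 0 = i -> active_upto i 0 0 s ->
  runs l z decode_hero s (active_upto i.+1 0 0).
Proof.
move=> ok okr okc ei act0; have et : neval s (scalar 2) = t by case: ok.
apply: (runs_for L_gt1 (I := fun j => active_upto i j 0)); rewrite ?et //.
- by apply: leq_trans t2_le; rewrite -addnn leq_addr.
- move=> j s' ltj nf rf act; apply: runs_decode_alliance => //.
  + by apply: eq_input_ok ok => -[|[|[|[|[|]]]]] // i' j' k _; rewrite /= /upd /= nf.
  + by case: okr => r0 r1; split=> *; rewrite [rmem _]/= rf.
  + by apply: eq_clique_ok okc => i' j' k; rewrite /= /upd /= nf.
  + by rewrite /= /upd /= nf.
- move=> s' _ _ act i' j' r' ltj'; rewrite act // ltj' orTb andbT.
  rewrite !ltn0 andbF orbF andbF orbF [(i' < i.+1)%N]ltnS [(i' <= i)%N]leq_eqVlt.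
  by rewrite [(i' == i) || _]orbC.
Qed.

Lemma runs_decode s : input_ok s -> reals_ok s -> clique_ok s ->
  (forall i j k, nmem s 9 i j k = 0%N) ->
  runs l z decode_cmd s (fun s' =>
    (forall i, (i < n)%N -> nmem s' 8 i 0 0 = switched_on i) /\
    (forall i j r, (i < n)%N -> (j < t)%N ->
       nmem s' 9 i j r = (r < 2)%N && activated i j r)).
Proof.
move=> ok okr okc zero; pose I i s' :=
  (forall i', (i' < i)%N -> nmem s' 8 i' 0 0 = switched_on i') /\ active_upto i 0 0 s'.
apply: (runs_for L_gt1 (I := I)); rewrite ?neval_nHeroes //.
- split=> // i' j' r' _; rewrite zero !ltn0 andbF orbF andbF.
  by case: (i' == _).
- move=> i s' lti nf rf [team act]; set s1 := nset s' 10 0 0 0 i.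
  have ok1 : input_ok s1.
    by apply: eq_input_ok ok => -[|[|[|[|[|]]]]] // i' j' k _; rewrite /= /upd /= nf.
  have okr1 : reals_ok s1.
    by case: okr => r0 r1; split=> *; rewrite [rmem _]/= rf.
  have okc1 : clique_ok s1.
    by apply: eq_clique_ok okc => i' j' k; rewrite /= /upd /= nf.
  have e10 : neval s1 (scalar 10) = i by [].
  apply: runs_seq; apply: (runs_nset L_gt1); rewrite neval_cliqueE // e10.
    exact: bitlen_bool.
  set s2 := nset s1 _ _ _ _ _ => bs2.
  have [||||//|b3 act3 k3] := @runs_decode_hero i s2 _ _ _ _ _ bs2.
  + by apply: eq_input_ok ok1 => -[|[|[|[|[|]]]]].
  + by [].
  + by apply: eq_clique_ok okc1.
  + by [].
  split=> //; split=> // i'; rewrite ltnS leq_eqVlt exec_nframe // => /orP[/eqP->|lti'].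
    by rewrite /s2 nmem_nset !eqxx.
  by rewrite /s2 nmem_nset /= andbT (ltn_eqF lti') /upd /=; exact: team.
- move=> s' _ _ [team act]; split=> // i j r lti ltj.
  by rewrite act // lti /=; case: (r < 2)%N.
Qed.

End Decode.

End Programs.

(** * Teams and assignments *)

Lemma ext_ord (A : Type) (x0 : A) n (f : 'I_n -> A) (i : 'I_n) : ext x0 f i = f i.
Proof. by rewrite /ext valK. Qed.

Lemma ext_lt (A : Type) (x0 : A) n (f : 'I_n -> A) i (lt : (i < n)%N) :
  ext x0 f i = f (Ordinal lt).
Proof. by rewrite /ext insubT. Qed.

Lemma ext_ge (A : Type) (x0 : A) n (f : 'I_n -> A) i : (n <= i)%N -> ext x0 f i = x0.
Proof. by move=> le; rewrite /ext insubN // -leqNgt. Qed.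

Lemma sum_pairs (R : realType) (F : nat -> R) t :
  \sum_(b < t.*2.+1) F b = F t.*2 + \sum_(j < t) (F j.*2 + F j.*2.+1).
Proof.
rewrite big_ord_recr /= addrC; congr +%R.
elim: t => [|t IH]; first by rewrite !big_ord0.
by rewrite doubleS 2!big_ord_recr /= IH [RHS]big_ord_recr /= addrA.
Qed.

Lemma sum_below2 (R : realType) q (g : nat -> R) :
  (forall k, (q <= k)%N || (1 < k)%N -> g k = 0) -> \sum_(k < q) g k = g 0%N + g 1%N.
Proof.
case: q => [|[|q]] g0.
- by rewrite big_ord0 !g0 ?addr0.
- by rewrite big_ord1 (g0 1%N) ?addr0.
- by rewrite 2!big_ord_recl /= big1 ?addr0 // => k _; rewrite g0 ?orbT.
Qed.

Section DULevel.
Context {R : realType} (D : du_instance R).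
Hypothesis size2 : alliances_of_size2 D.

Implicit Types x y : nat -> bool.

Let n := heroes D.
Let t := alliances D.
Let m := team_size D.
(** Read off the machine input, so that the data of the programs and those of the graph agree by
    construction. *)
Definition du_memb (i j : nat) : bool := nmem (du_input D) 4 i j 0 != 0%N.
Definition du_str (i : nat) : R := rmem (du_input D) 0 i 0 0.
Definition du_bon (i j k : nat) : R := rmem (du_input D) 1 i j k.

Lemma du_membE (i : 'I_n) (j : 'I_t) : du_memb i j = member i j.
Proof. by rewrite /du_memb /= !ext_ord; case: member. Qed.

Lemma du_strE (i : 'I_n) : du_str i = strength i.
Proof. by rewrite /du_str /= ext_ord. Qed.

Lemma du_bonE (i : 'I_n) (j : 'I_t) (k : 'I_(max_alliance D)) :
  du_bon i j k = bonus i j k.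
Proof. by rewrite /du_bon /= !ext_ord. Qed.

Lemma du_bon_ge (i : 'I_n) (j : 'I_t) k : (max_alliance D <= k)%N -> du_bon i j k = 0.
Proof. by move=> le; rewrite /du_bon /= !ext_ord ext_ge. Qed.

Notation du_table := (table t du_str du_bon).
Notation du_score := (score n t du_table).
Notation du_consistent := (consistent n t m du_memb).

Definition gain (x y : nat -> bool) (i j k : nat) : R :=
  if [&& (k < 2)%N, x i & y (j.*2 + k)%N] then Num.max 0 (du_bon i j k) else 0.

Lemma gain_ge0 x y i j k : 0 <= gain x y i j k.
Proof. by rewrite /gain; case: ifP => // _; rewrite le_max lexx. Qed.

(** Columns [2j] and [2j + 1] become the two thresholds of alliance [j]. The extended bonus is 0
    from [max_alliance] on and nothing is gained past the second threshold, so summing over all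
    thresholds gives the same total. *)
Lemma du_score_gain x y : y t.*2 ->
  du_score x y = \sum_(i < n) (x i)%:R * strength i +
    \sum_(i < n) \sum_(j < t) \sum_(k < max_alliance D) gain x y i j k.
Proof.
move=> yt; rewrite -big_split; apply: eq_bigr => i _ /=.
rewrite (sum_pairs (fun b => if x i && y b then du_table i b else 0)) yt andbT.
congr +%R; first by rewrite /table ltnn du_strE; case: (x i); rewrite ?mul1r ?mul0r.
apply: eq_bigr => j _; rewrite sum_below2 => [|k /orP[le|lt]].
- rewrite /gain /table /= addn0 addn1 !divn2 !modn2 /= odd_double doubleK uphalf_double.
  have := ltn_ord j; rewrite -ltn_double => lt; rewrite lt.
  by rewrite (leq_trans (ltnSn _)) ?ltn_Sdouble // -ltn_double.
- by rewrite /gain; case: ifP => // _; rewrite du_bon_ge ?maxxx.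
- by rewrite /gain ltnNge lt.
Qed.

(** Activating only the nonnegative ones among the available bonuses realizes the truncation at
    0. *)
Lemma du_value_score (S : du_solution D) x y : y t.*2 ->
  (forall i, in_team S i = x i) ->
  (forall i j k, active S i j k =
     [&& (k < 2)%N, x i, y (j.*2 + k)%N & 0 <= du_bon i j k]) ->
  du_value S = du_score x y.
Proof.
move=> yt tS aS; rewrite du_score_gain // /du_value; congr +%R.
  by apply: eq_bigr => i _; rewrite tS.
apply: eq_bigr => i _; apply: eq_bigr => j _; apply: eq_bigr => k _.
rewrite aS -du_bonE /gain; case: (k < 2)%N; last by rewrite mulr0.
case: (x i); last by rewrite mulr0.
case: (y _); last by rewrite mulr0.
by rewrite /=; case: leP => h; rewrite ?mulr1 ?mulr0.
Qed.

Lemma du_consistent_feasible (S : du_solution D) x y : du_consistent x y ->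
  (forall i, in_team S i = x i) ->
  (forall i j k, active S i j k =
     [&& (k < 2)%N, x i, y (j.*2 + k)%N & 0 <= du_bon i j k]) ->
  du_feasible S.
Proof.
move=> [x_le _ y_even y_odd] tS aS; split.
- by under eq_bigr do rewrite tS.
- by move=> i j k; rewrite aS tS; case: (k < 2)%N; case: (x i) => //=; case: (_ && _).
move=> i j k; have ltq : (max_alliance D)%:R < bigM D by case: D.
case E: (active S i j k); last first.
  (* For an inactive bonus the constraint asks that [k + 1] be at most the count plus [M], which
     holds since [k + 1 <= q < M]. *)
  rewrite sub0r mulrN1 -subr_ge0 opprK addrAC subr_ge0.
  apply: ler_wpDl => //; apply/ltW/(le_lt_trans _ ltq); rewrite ler_nat; exact: ltn_ord.
rewrite subrr mulr0 subr_ge0 ler_nat.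
move: E; rewrite aS => /and4P[ltk _ yk _].
have [k0|k1] : k = 0%N :> nat \/ k = 1%N :> nat by lia.
  move: yk; rewrite k0 addn0 => yk; have [u ltu /andP[mu xu]] := y_even j (ltn_ord j) yk.
  rewrite (bigD1 (Ordinal ltu)) //= tS -du_membE /= mu xu; lia.
(* Second threshold: all members are in the team, and there are two of them. *)
rewrite k1 -(size2 j); apply: leq_sum => i' _; rewrite tS -du_membE.
case mu: (du_memb _ _) => //=; rewrite mul1n lt0b.
by apply: (y_odd j); rewrite // -addn1 -k1.
Qed.

(** Makes every claim that is true of the team [x], and keeps the last group on. *)
Definition du_claims (x : nat -> bool) (b : nat) : bool :=
  (b == t.*2) ||
  (if odd b then [forall u : 'I_n, du_memb u b./2 ==> x u]
   else [exists u : 'I_n, du_memb u b./2 && x u]).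

(** An active bonus has its threshold reached, so it is at most its gain; an inactive one
    contributes 0, and gains are nonnegative. *)
Lemma du_feasible_score (S : du_solution D) : du_feasible S ->
  exists x y, du_consistent x y /\ du_value S <= du_score x y.
Proof.
move=> [S_le S_act S_cnt].
pose x := ext false (in_team S); exists x, (du_claims x).
have xE (i : 'I_n) : x i = in_team S i by rewrite /x ext_ord.
have yt : du_claims x t.*2 by rewrite /du_claims eqxx.
split.
  split=> //; first by under eq_bigr do rewrite xE.
  - move=> j ltj; rewrite /du_claims; have -> : (j.*2 == t.*2) = false by lia.
    rewrite odd_double doubleK => /existsP[u mxu]; by exists u.
  - move=> j u ltj; rewrite /du_claims; have -> : (j.*2.+1 == t.*2) = false by lia.
    rewrite /= odd_double uphalf_double => /forallP h ltu mu.
    by have := h (Ordinal ltu); rewrite /= mu.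
rewrite du_score_gain // /du_value; apply: lerD.
  by apply: ler_sum => i _; rewrite xE.
apply: ler_sum => i _; apply: ler_sum => j _; apply: ler_sum => k _.
case E: (active S i j k); last by rewrite mulr0 gain_ge0.
rewrite mulr1 -du_bonE.
have ti : in_team S i by have := S_act i j k; rewrite E lt0b.
have := S_cnt i j k; rewrite E subrr mulr0 subr_ge0 ler_nat => lt_cnt.
(* A member outside the team lowers the count below 2. This excludes thresholds above two heroes
   and, when two are required, forces every member into the team. *)
have cnt_le u :
    (\sum_i' member i' j * in_team S i' + (member u j && ~~ in_team S u) <= 2)%N.
  rewrite -(size2 j) (bigD1 u) //= [X in (_ <= X)%N](bigD1 u) //=.
  have : (\sum_(i0 | i0 != u) member i0 j * in_team S i0 <=
          \sum_(i0 | i0 != u) member i0 j)%N.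
    by apply: leq_sum => i' _; case: member; case: in_team.
  by case: member; case: in_team; rewrite /=; lia.
have ltk : (k < 2)%N by apply: leq_trans lt_cnt _; have := cnt_le i; lia.
rewrite /gain ltk xE ti /=.
have -> : du_claims x (j.*2 + k); last by rewrite le_max lexx orbT.
have ltj2 : (j.*2 + k == t.*2) = false by have := ltn_ord j; lia.
rewrite /du_claims ltj2 /=.
have [k0|k1] : k = 0%N :> nat \/ k = 1%N :> nat by lia.
  rewrite k0 addn0 odd_double doubleK; apply: contraT => /existsPn none.
  move: lt_cnt; rewrite big1 // => u _; have := none u; rewrite du_membE xE.
  by case: member; case: in_team.
rewrite k1 addn1 /= odd_double uphalf_double; apply/forallP => u.
rewrite du_membE xE; case mu: (member u j) => //=; case tu: (in_team S u) => //.
rewrite k1 in lt_cnt; have := cnt_le u; rewrite mu tu /= addn1 => h.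
by have := leq_ltn_trans lt_cnt h.
Qed.

(** Treated apart because the clique arguments need a hero; without heroes every solution has value
    0. *)
Lemma du_idle_optimal (S : du_solution D) : n = 0%N -> du_optimal S.
Proof.
move=> n0; have no (i : 'I_n) : False by have := ltn_ord i; rewrite [X in (_ < X)%N]n0.
have value0 (S' : du_solution D) : du_value S' = 0.
  by rewrite /du_value !big1 ?addr0 // => i; case: (no i).
split; last by move=> S' _; rewrite !value0.
by split=> [|i|i]; [rewrite big1 // => i | |]; case: (no i).
Qed.

Notation du_G := (du_graph n t m du_memb du_table (bigW n t du_str du_bon)).

Lemma du_max_clique_optimal (K : {set 'I_(nverts du_G)}) (S : du_solution D) :
  max_clique K ->
  (forall i, in_team S i = switched_on n (ext false (fun v => v \in K)) i) ->
  (forall i j k, active S i j k =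
     (k < 2)%N && activated n du_bon (ext false (fun v => v \in K)) i j k) ->
  du_optimal S.
Proof.
move=> maxK tS aS; have [n0|n_gt0] := posnP n; first exact: du_idle_optimal.
have W_big : \sum_(i < n) \sum_(b < t.*2.+1) Num.max 0 (du_table i b) <
    bigW n t du_str du_bon by rewrite /bigW ltrDr.
have /= [full cons best] := max_clique_score maxK n_gt0 W_big.
(* The group meets [K] in exactly one vertex, so it is off iff its vertex of state 0 is that one. *)
have onE g : (g < du_groups n t)%N ->
    switched_on n (ext false (fun v : 'I_(nverts du_G) => v \in K)) g =
    (0 < sel_sta K g)%N.
  move=> ltg; have [v [Kv gv sv]] := sel_staP (full g ltg).
  have lt := vertex_subproof ltg (leq0n n); rewrite addn0 in lt.
  rewrite /switched_on ext_lt -sv lt0n; congr negb.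
  apply/idP/eqP => [K0 | s0].
    have -> : v = Ordinal lt.
      apply: (clique_grp_inj (proj1 maxK)) => //.
      by rewrite gv /= -(addn0 (g * _)%N) grp_vertex.
    by rewrite /= -(addn0 (g * _)%N) sta_vertex.
  suff <- : v = Ordinal lt by [].
  by apply/val_inj/(@vertex_eq n); rewrite /= -(addn0 (g * _)%N) ?grp_vertex ?sta_vertex.
set x := fun i => _ in cons best; set y := fun b => _ in cons best.
have tx (i : 'I_n) : in_team S i = x i.
  by rewrite tS onE // /du_groups ltn_addr.
have ay (i : 'I_n) (j : 'I_t) k : active S i j k =
    [&& (k < 2)%N, x i, y (j.*2 + k)%N & 0 <= du_bon i j k].
  rewrite aS; case: (ltnP k 2) => //= ltk; rewrite /activated !onE //.
    rewrite /du_groups ltn_add2l; have := ltn_ord j.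
    by move: (j : nat) (k : nat) ltk; lia.
  by rewrite /du_groups ltn_addr.
split; first exact: du_consistent_feasible cons tx ay.
move=> S' /du_feasible_score[x' [y' [cons' le']]].
rewrite (du_value_score _ tx ay); last by case: cons.
exact: le_trans le' (best _ _ cons').
Qed.

End DULevel.

(** * The reduction *)

(* Bounds both the order of the graph and the bit-length of the data. *)
Definition size_poly : {poly nat} := 16%:P * 'X^2.

(** The first two terms bound the vertices and the edges, the other two the running times. *)
Definition du_poly : {poly nat} :=
  size_poly + size_poly ^+ 2 + cmd_steps size_poly reduce_cmd +
  cmd_steps size_poly decode_cmd.

Lemma size_polyE z : size_poly.[z] = (16 * z ^ 2)%N.
Proof. by rewrite /size_poly !hornerE. Qed.

Lemma du_polyE z : du_poly.[z] =
  ((16 * z ^ 2) + (16 * z ^ 2) ^ 2 + (cmd_steps size_poly reduce_cmd).[z]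
   + (cmd_steps size_poly decode_cmd).[z])%N.
Proof. by rewrite /du_poly !hornerD horner_exp size_polyE. Qed.

(** * The input and its size *)

Section Input.
Context {R : realType} (D : du_instance R).
Hypothesis size2 : alliances_of_size2 D.

Let n := heroes D.
Let t := alliances D.
Let z := du_size D.
Let L := size_poly.[z].

(** The input size contains [t] only through its bit-length, so [t] is bounded by the size of the
    incidence matrix instead; without heroes there is no alliance of size 2. *)
Lemma alliances_le : (t <= n * t)%N.
Proof.
case n0: n => [|k]; last by rewrite leq_pmull.
rewrite leqNgt; apply/negP => t_gt0; have := size2 (Ordinal t_gt0).
rewrite big1 // => i; have := ltn_ord i; by rewrite [X in (_ < X)%N]n0.
Qed.

Lemma du_order_lt : (du_order n t < L)%N.
Proof.
have := alliances_le; rewrite /L size_polyE /z /du_size -/n -/t /du_order /du_groups.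
set w := (_ + 1)%N => le.
have hn : (n <= w)%N by rewrite /w; lia.
have ht : (t <= w)%N by rewrite /w; lia.
have hw : (0 < w)%N by rewrite /w addn1.
(* The order is at most [(3w + 1)(w + 1) <= 8w^2], below [16w^2]. *)
by move: hn ht hw; clear le; move: w; nia.
Qed.

Lemma du_length_gt1 : (1 < L)%N.
Proof. by rewrite /L size_polyE /z /du_size addn1; nia. Qed.

Lemma du_size_le : (z <= L)%N.
Proof. by rewrite /L size_polyE; nia. Qed.

Lemma bitlen_ext_bool k (f : 'I_k -> bool) i :
  (bitlen (ext 0%N (fun v => f v : nat) i) <= L)%N.
Proof.
apply: leq_trans du_length_gt1; apply: leq_trans (bitlen_leqS _) _; rewrite ltnS.
by rewrite /ext; case: insub => //= v; case: (f v).
Qed.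

Lemma bounded_du_input : bounded L (du_input D).
Proof.
have b0 : (bitlen 0 <= L)%N by apply: leq_trans (bitlen_leqS _) (ltnW du_length_gt1).
have bz k : (k <= z)%N -> (k <= L)%N by move=> h; apply: leq_trans h du_size_le.
move=> [|[|[|[|[|a]]]]] i j k /=.
1-4: by case: i j k => [|i] [|j] [|k] //; apply: bz; rewrite /z /du_size; lia.
- case: k => [|k] //; rewrite {1}/ext; case: insub => [i'|] //; exact: bitlen_ext_bool.
- by [].
Qed.

Lemma input_ok_du_input : input_ok n t (team_size D) (du_memb D) (du_input D).
Proof.
split=> // i j; rewrite /du_memb /= /ext; case: insub => // i'; case: insub => // j'.
by case: member.
Qed.

Lemma reals_ok_du_input : reals_ok (du_str D) (du_bon D) (du_input D).
Proof. by []. Qed.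

Lemma nmem_clique_input k (K : {set 'I_k}) a i j l : a != 7%N ->
  nmem (du_clique_input D K) a i j l = nmem (du_input D) a i j l.
Proof. by case: a => [|[|[|[|[|[|[|[|a]]]]]]]]. Qed.

Lemma bounded_clique_input k (K : {set 'I_k}) : bounded L (du_clique_input D K).
Proof.
move=> a i j l; have [->|ne] := eqVneq a 7%N; last first.
  by rewrite nmem_clique_input //; apply: bounded_du_input.
rewrite /=; case: j => [|j]; last exact: (bounded_du_input 7 i j.+1 l).
case: l => [|l]; last exact: (bounded_du_input 7 i 0 l.+1).
exact: bitlen_ext_bool.
Qed.

Lemma clique_ok_input k (K : {set 'I_k}) :
  clique_ok (ext false (fun v => v \in K)) (du_clique_input D K).
Proof. by move=> i; rewrite /= /ext; case: insub. Qed.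

End Input.

Theorem theorem5 (R : realType) :
  exists (reduce decode : cmd) (p : {poly nat}),
  forall D : du_instance R, alliances_of_size2 D ->
  exists G : wgraph R,
    [/\ graph_output (exec reduce (du_input D)) G,
        (cost reduce (du_input D) <= p.[du_size D])%N,
        (graph_size G <= p.[du_size D])%N
      & forall K : {set 'I_(nverts G)}, max_clique K ->
          (cost decode (du_clique_input D K) <= p.[du_size D])%N /\
          du_optimal (du_output D (exec decode (du_clique_input D K)))].
Proof.
exists reduce_cmd, decode_cmd, du_poly => D size2.
set n := heroes D; set t := alliances D.
set tab := table t (du_str D) (du_bon D); set W := bigW n t (du_str D) (du_bon D).
exists (du_graph n t (team_size D) (du_memb D) tab W); rewrite du_polyE.
have L_gt1 := du_length_gt1 D; have lt_L := du_order_lt size2.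
have ok := input_ok_du_input D.
have okr := reals_ok_du_input D.
have [|_ [out5 rows] cost_red] := runs_reduce L_gt1 lt_L ok okr _ (bounded_du_input D).
  by move=> [|[|[|a]]].
split.
- split=> //= u v.
    by have [|->] := rows u v (ltn_ord u) (ltn_ord v); [rewrite ltn_ord | case: du_adj].
  by move=> _; have [|_ ->] := rows u v (ltn_ord u) (ltn_ord v); rewrite ?ltn_ord.
- by lia.
- rewrite size_polyE in lt_L; rewrite /graph_size /=.
  rewrite -2!addnA; apply: leq_add; first exact: ltnW.
  apply: leq_trans (max_card _) _; rewrite card_prod card_ord -mulnn.
  by apply: leq_trans (leq_addr _ _); apply: leq_mul; apply: ltnW.
- move=> K maxK.
  have okK : input_ok n t (team_size D) (du_memb D) (du_clique_input D K).
    by apply: eq_input_ok ok => a i j k lta; apply: nmem_clique_input; lia.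
  have [|_ [team act] cost_dec] :=
    runs_decode L_gt1 lt_L okK okr (clique_ok_input D K) _ (bounded_clique_input D K).
    by [].
  split; first by lia.
  apply: (du_max_clique_optimal size2 maxK) => [i | i j k] /=.
    by rewrite team ?ltn_ord //; case: switched_on.
  by rewrite act ?ltn_ord //; case: (_ && _).
Qed.
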